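(* Let $c:\mathcal U\to(0,\infty)$ be an arbitrary control cost function. For $i\in\{0,\dots,M-1\}$ write $$d_i^* \triangleq \max_{q(\cdot|\cdot)}\ \frac{\min_{j\ne i}\ \sum_{\tilde y\in\mathcal Y,\,u\in\mathcal U}\mu_i^q(\tilde y)\,q(u|\tilde y)\,D\big(p_i^u(\cdot|\tilde y)\,\|\,p_j^u(\cdot|\tilde y)\big)}{\sum_{\tilde y\in\mathcal Y,\,u\in\mathcal U}\mu_i^q(\tilde y)\,q(u|\tilde y)\,c(u)},$$ the maximum being over all conditional pmfs $q(u|\tilde y)$. For any positive tuple $(\bar R_0,\dots,\bar R_{M-1})$, consider the test that uses the control policy $\phi^*$ described in the context (with exploration parameter $a>1$ sufficiently close to $1$), the stopping rule $$N^*=\min\Big\{n\ge1:\ \frac{p_{\hat i_n}(Y^n,U^n)}{\max_{j\ne\hat i_n}p_j(Y^n,U^n)}>\frac1{\bar R_{\hat i_n}}\Big\},$$ and the decision $\delta^*=\hat i_{N^*}$. Let $P^*_{\max}$, $R^*_0,\dots,R^*_{M-1}$ be its maximal error probability and risks. Then $R_i^*\le\bar R_i$ for every $i=0,\dots,M-1$. Furthermore, as $\max_i\bar R_i\to0$ while satisfying $\max_i\bar R_i\le K\min_i\bar R_i$ for some constant $K$, this test is asymptotically optimal, i.e., for each $i=0,\dots,M-1$, $$\mathbb E_i\Big[\sum_{k=1}^{N^*} c(U_k)\Big]=\frac{-\log P^*_{\max}}{d_i^*}(1+o(1))=\Big(\inf_{(\phi,N,\delta)\in\mathbb C(P^*_{\max})}\mathbb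 E_i\Big[\sum_{k=1}^{N} c(U_k)\Big]\Big)(1+o(1))$$ $$=\frac{-\log R^*_i}{d_i^*}(1+o(1))=\Big(\inf_{(\phi,N,\delta)\in\mathbb C'(R^*_0,\dots,R^*_{M-1})}\mathbb E_i\Big[\sum_{k=1}^{N} c(U_k)\Big]\Big)(1+o(1)).$$
   Context: Observation model. $\mathcal Y$ (observations) and $\mathcal U$ (controls) are finite sets; there are $M$ hypotheses $0,\dots,M-1$. For each hypothesis $i$ and $u\in\mathcal U$, $p_i^u(\cdot|\cdot)$ is a given transition probability from $\mathcal Y$ to itself, and $p_i^u(y|\tilde y)>0$ for all $i,u,y,\tilde y$. The initial observation $y_0$ is a constant. Under hypothesis $i$, conditioned on $(u_k,y_{k-1})$, the observation $Y_k$ is conditionally independent of all earlier observations and controls $(y^{k-2},u^{k-1})$ and has distribution $p_i^{u_k}(\cdot|y_{k-1})$, $k=1,2,\dots$. Here $y^k=(y_1,\dots,y_k)$, $u^k=(u_1,\dots,u_k)$. Policies and tests. A causal control policy $\phi$ is a collection of conditional pmfs $q_1(u_1|y_0)$ and $q_k(u_k|y^{k-1},u^{k-1})$, $k\ge2$, specifying the (randomized) control $U_k$. Under hypothesis $i$ the joint pmf is $$p_i(y^n,u^n)=q_1(u_1|y_0)\prod_{k=1}^n p_i^{u_k}(y_k|y_{k-1})\prod_{k=2}^n q_k(u_k|y^{k-1},u^{k-1}).$$ $\mathbb P_i,\mathbb E_i$ denote probability and expectation under hypothesis $i$. A sequential test $(\phi,N,\delta)$ consists of a causal control policy $\phi$,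 a stopping time $N$ with respect to $\mathcal F_k=\sigma(Y^k,U^k)$, and a decision rule $\delta=\delta(Y^N,U^N)\in\{0,\dots,M-1\}$. Error criteria. $P_{\max}=\max_i\mathbb P_i\{\delta\ne i\}$; the risks are $R_i=\max_{j\ne i}\mathbb P_j\{\delta=i\}$. $\mathbb C(\alpha)$ is the class of tests with $P_{\max}\le\alpha$, and $\mathbb C'(\beta_0,\dots,\beta_{M-1})$ the class of tests with $R_i\le\beta_i$ for all $i$. $D(p_1\|p_2)=\sum_y p_1(y)\log\frac{p_1(y)}{p_2(y)}$ is the Kullback–Leibler distance. Stationary distributions. For a conditional pmf $q(u|\tilde y)$, $\mu_i^q$ is the unique stationary distribution of the transition probabilities $p_i^q(y|\tilde y)=\sum_{u}q(u|\tilde y)p_i^u(y|\tilde y)$ on $\mathcal Y$. The control policy $\phi^*$. For each $i$ let $q_i^*(\cdot|\cdot)$ be a conditional pmf attaining the maximum in the definition of $d_i^*$ (see the claim). Let $\hat i_n=\operatorname{argmax}_{i}p_i(Y^n,U^n)$ be the maximum likelihood (ML) estimate of the hypothesis. At times $k=\lceil a^\ell\rceil$, $\ell=0,1,2,\dots$, $U_k$ is uniformly distributed on $\mathcal U$, independently of all past observations and controls; at all other times $U_k\sim q^*_{\hat i_{k-1}}(\cdot|y_{k-1})$. Here $a>1$ is a fixed constant chosen sufficiently close to $1$. *)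

(* Defs.v *)
From HB Require Import structures.
From mathcomp Require Import all_boot all_order all_algebra.
From mathcomp Require Import all_classical all_reals all_analysis.
Set Implicit Arguments.
Unset Strict Implicit.
Unset Printing Implicit Defensive.
Import Order.TTheory GRing.Theory Num.Theory.
Import numFieldNormedType.Exports.
Local Open Scope classical_set_scope.
Local Open Scope ring_scope.

Definition is_pmf (R : realType) (T : finType) (f : T -> R) : Prop :=
  (forall x, 0 <= f x) /\ \sum_x f x = 1.

(* Kullback-Leibler distance, in nats; only used between positive pmfs. *)
Definition KL (R : realType) (T : finType) (f g : T -> R) : R :=
  \sum_x f x * ln (f x / g x).

(* [A x = B x * (1 + o(1))] along [F]; [A] and [B] may take infinite values. *)
Definition asymp_eq (R : realType) (T : Type) (F : set_system T)
    (A B : T -> \bar R) : Prop :=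
  exists2 o : T -> R, o x @[x --> F] --> (0 : R) &
    \forall x \near F, A x = (B x * (1 + o x)%:E)%E.

(* The regime max_i r_i -> 0 over positive tuples r with
   max_i r_i <= K min_i r_i. *)
Definition vanishing (R : realType) (M : nat) (K : R) : set_system ('I_M -> R) :=
  filter_from [set e : R | 0 < e] (fun e => [set r |
    [/\ forall i, 0 < r i,
        (\big[maxe/0%E]_(i < M) (r i)%:E < e%:E)%E &
        (\big[maxe/0%E]_(i < M) (r i)%:E
           <= K%:E * \big[mine/+oo%E]_(i < M) (r i)%:E)%E]]).

(* Random times have values in [option nat], [None] standing for +oo. *)
Definition time_le (t : option nat) (n : nat) : bool :=
  if t is Some m then (m <= n)%N else false.

Definition time_gt (t : option nat) (n : nat) : bool :=
  if t is Some m then (n < m)%N else true.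

Definition first_time (Q : pred nat) : option nat :=
  if pselect (exists n, Q n) is left exQ then Some (ex_minn exQ) else None.

(* [p i u yt y] is p_i^u(y | yt), [q yt u] is q(u | yt), and a history
   [:: (y_1, u_1); ...; (y_n, u_n)] is a [seq (Y * U)].  A causal policy [phi]
   maps the history up to time k - 1 to the pmf q_k of the control at time k. *)
Section ControlledSensing.
Variables (R : realType) (Y U : finType) (M : nat).
Variables (p : 'I_M -> U -> Y -> Y -> R) (y0 : Y) (c : U -> R).

Definition is_cond_pmf (q : Y -> U -> R) : Prop := forall yt, is_pmf (q yt).

Definition mixed_kernel (i : 'I_M) (q : Y -> U -> R) (yt y : Y) : R :=
  \sum_u q yt u * p i u yt y.

Definition is_stationary (k : Y -> Y -> R) (mu : Y -> R) : Prop :=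
  is_pmf mu /\ forall y, \sum_yt mu yt * k yt y = mu y.

(* The stationary distribution is unique when [p] is positive and [q] is a
   conditional pmf; the default value of [xget] is then irrelevant. *)
Definition stat_dist (i : 'I_M) (q : Y -> U -> R) : Y -> R :=
  xget (fun=> 0) [set mu | is_stationary (mixed_kernel i q) mu].

Definition info_rate (q : Y -> U -> R) (i j : 'I_M) : R :=
  \sum_yt \sum_u stat_dist i q yt * q yt u * KL (p i u yt) (p j u yt).

Definition cost_rate (q : Y -> U -> R) (i : 'I_M) : R :=
  \sum_yt \sum_u stat_dist i q yt * q yt u * c u.

Definition reward (i : 'I_M) (q : Y -> U -> R) : \bar R :=
  ((\big[mine/+oo]_(j < M | j != i) (info_rate q i j)%:E)
     / (cost_rate q i)%:E)%E.

Definition dstar (i : 'I_M) : \bar R :=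
  ereal_sup [set reward i q | q in [set q | is_cond_pmf q]].

Definition attains_dstar (i : 'I_M) (q : Y -> U -> R) : Prop :=
  is_cond_pmf q /\ reward i q = dstar i.

Definition last_obs (h : seq (Y * U)) : Y := last y0 (map fst h).

Definition is_policy (phi : seq (Y * U) -> U -> R) : Prop :=
  forall h, is_pmf (phi h).

(* p_i(y^n, u^n) at h = (y^n, u^n), under the policy [phi]. *)
Definition joint_pmf (phi : seq (Y * U) -> U -> R) (i : 'I_M)
    (h : seq (Y * U)) : R :=
  (\prod_(k < size h) p i (tnth (in_tuple h) k).2 (last_obs (take k h))
                         (tnth (in_tuple h) k).1)
  * \prod_(k < size h) phi (take k h) (tnth (in_tuple h) k).2.

(* [X k] is the pair (Y_{k+1}, U_{k+1}). *)
Definition hist (Omega : Type) (X : nat -> Omega -> Y * U) (n : nat)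
    (w : Omega) : seq (Y * U) := mkseq (fun k => X k w) n.

(* F_n, the sigma-algebra generated by the discrete random variable
   (Y^n, U^n). *)
Definition natural_filtration (Omega : Type) (X : nat -> Omega -> Y * U)
    (n : nat) : set_system Omega :=
  preimage_set_system setT (hist X n) setT.

(* A sequential test together with a probability space carrying the processes
   (Y_k, U_k) it generates; [prob i] is the probability under hypothesis i. *)
Record seq_test := SeqTest {
  disp : measure_display;
  space : measurableType disp;
  prob : 'I_M -> probability space R;
  proc : nat -> space -> Y * U;
  policy : seq (Y * U) -> U -> R;
  stop : space -> option nat;
  decision : seq (Y * U) -> 'I_M;
  policyP : is_policy policy;
  proc_measurable : forall k z, measurable (proc k @^-1` [set z]);
  proc_law : forall i h,
    prob i [set w | hist proc (size h) w = h] = (joint_pmf policy i h)%:E;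
  stopP : forall n,
    natural_filtration proc n [set w | time_le (stop w) n]
}.
Arguments proc : clear implicits.
Arguments stop : clear implicits.

(* {delta = i} and {delta <> i}; a decision is made only if N is finite. *)
Definition accepts (t : seq_test) (i : 'I_M) : set (space t) :=
  [set w | exists2 n, stop t w = Some n & decision t (hist (proc t) n w) = i].

Definition errs (t : seq_test) (i : 'I_M) : set (space t) :=
  [set w | exists2 n, stop t w = Some n & decision t (hist (proc t) n w) <> i].

Arguments accepts : clear implicits.
Arguments errs : clear implicits.

Definition P_max (t : seq_test) : \bar R :=
  \big[maxe/0%E]_(i < M) prob t i (errs t i).

Definition risk (t : seq_test) (i : 'I_M) : \bar R :=
  \big[maxe/0%E]_(j < M | j != i) prob t j (accepts t i).

Definition total_cost (t : seq_test) (w : space t) : \bar R :=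
  (\sum_(0 <= k <oo | time_gt (stop t w) k) (c (proc t k w).2)%:E)%E.

Definition expected_cost (t : seq_test) (i : 'I_M) : \bar R :=
  (\int[prob t i]_w total_cost w)%E.

(* Classes of tests are plain predicates, because [seq_test] is too large a
   type to be the carrier of a [set]. *)
Definition class_C (alpha : \bar R) (t : seq_test) : Prop :=
  (P_max t <= alpha)%E.

Definition class_C' (beta : 'I_M -> \bar R) (t : seq_test) : Prop :=
  forall i, (risk t i <= beta i)%E.

Definition inf_cost (C : seq_test -> Prop) (i : 'I_M) : \bar R :=
  ereal_inf [set x | exists2 t, C t & x = expected_cost t i].

Section ProposedTest.
Variables (a : R) (qstar : 'I_M -> Y -> U -> R) (ihat : seq (Y * U) -> 'I_M).

Definition exploration_time (k : nat) : bool :=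
  `[< exists l : nat, k%:Z = Num.ceil (a ^+ l) >].

Definition policy_star (h : seq (Y * U)) (u : U) : R :=
  if exploration_time (size h).+1 then #|U|%:R^-1
  else qstar (ihat h) (last_obs h) u.

(* [ihat] is a maximum likelihood estimator, with arbitrary tie-breaking. *)
Definition is_ML : Prop :=
  forall h j, joint_pmf policy_star j h <= joint_pmf policy_star (ihat h) h.

Definition likelihood_ratio (h : seq (Y * U)) : R :=
  joint_pmf policy_star (ihat h) h
  / \big[Num.max/0]_(j < M | j != ihat h) joint_pmf policy_star j h.

Definition stop_star (Rbar : 'I_M -> R) (Omega : Type)
    (X : nat -> Omega -> Y * U) (w : Omega) : option nat :=
  first_time (fun n => (0 < n)%N &&
    ((Rbar (ihat (hist X n w)))^-1 < likelihood_ratio (hist X n w))).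

Definition is_proposed_test (Rbar : 'I_M -> R) (t : seq_test) : Prop :=
  [/\ forall h u, policy t h u = policy_star h u,
      forall w, stop t w = stop_star Rbar (proc t) w &
      forall h, decision t h = ihat h].

End ProposedTest.

End ControlledSensing.

Arguments class_C {R Y U M} p y0 alpha t.
Arguments class_C' {R Y U M} p y0 beta t.

(* Main.v *)
Require Import Defs.
From mathcomp Require Import all_boot all_order all_algebra.
From mathcomp Require Import all_classical all_reals all_analysis.
From mathcomp Require Import measurable_realfun ring lra zify.
Import Order.TTheory GRing.Theory Num.Theory.
Import numFieldNormedType.Exports.
Local Open Scope classical_set_scope.
Local Open Scope ring_scope.
Set Implicit Arguments.
Unset Strict Implicit.
Unset Printing Implicit Defensive.

(** Everything that the theorem compares depends on the law of finite
    histories only, so the proof works with finite sums over histories: expected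
    costs are suprema of sums over the histories seen before the stopping time
    ([run_cost_le], [expected_cost_bound]), and stopped processes are handled by
    Dynkin's formula ([dynkin]) and by a change of measure at the stopped
    history ([change_of_measure]).

    Converse ([converse_test]).  If a test accepts [i] with probability at most
    [expR (- s)] under every alternative [j], then the expected log-likelihood
    ratio of [i] against every [j] at the stopping time is at least about [s]
    ([data_processing]).  This expectation is the integral of the
    Kullback-Leibler distances, and the expected cost is the integral of [c],
    with respect to the measure that counts the expected visits to each pair of
    a state and a control.  The flow of that measure through each state is
    balanced up to 1, so, the kernels being uniformly positive, it is within a
    bounded distance of a multiple of a stationary measure
    ([occupation_measure]).  For stationary measures the ratio of the two
    integrals, minimized over [j], is at most [dstar] by definition.  Hence
    [s * (1 - e) <= dstar * cost + C], where [e] bounds the error probability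
    under [i] and [C] does not depend on the test.

    Achievability ([achievability_finite]).  The likelihoods of two
    distinguishable hypotheses separate at a geometric rate in the number of
    explorations, which grows like [ln n / ln a]; for [a] close to 1 the error
    probabilities of the estimator are therefore summable
    ([ML_errors_summable]).  As explorations have density 0, under [i] the
    control [qs i] is used at all but a vanishing proportion of times.  The
    test stops as soon as all log-likelihood ratios of [i] exceed
    [b = - ln (Rbar i)].  A soft minimum of these ratios, corrected by the
    solutions of Poisson equations, turns this into a single potential with
    upward drift [min_j info_rate] ([expected_time_le]), so the expected
    stopping time is at most [b / min_j info_rate * (1 + o(1))], and the
    expected cost, [cost_rate] times as large up to lower order terms
    ([expected_cost_le]), is at most [b / dstar * (1 + o(1))].

    A change of measure bounds the risks by [Rbar] ([proposed_risk]).  Thus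
    [- ln (P_max)] and [- ln (risk i)] are at least [b] up to a constant, while
    the converse, applied to the proposed test itself, bounds them from above;
    applied to an arbitrary competitor, it bounds the infima of the costs from
    below ([sandwich_distinguishable]).  If [i] coincides with some other
    hypothesis, [dstar] is 0 and all the quantities compared are eventually
    infinite
    ([sandwich_indistinguishable]). *)

(** * Positive stochastic matrices *)

Section PositiveKernel.
Variables (R : realType) (Y : finType) (P : Y -> Y -> R) (eps : R).
Hypothesis eps_gt0 : 0 < eps.
Hypothesis P_ge : forall x y, eps <= P x y.
Hypothesis P_sum : forall x, \sum_y P x y = 1.

(** Subtracting the constant [eps] from the kernel does not change its action
    on a vector of total mass 0, but lowers its row sums to [1 - #|Y| eps]. *)
Lemma doeblin_contraction (w : Y -> R) : \sum_y w y = 0 ->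
  #|Y|%:R * eps * \sum_y `|w y|
    <= \sum_y `|w y - \sum_x w x * P x y|.
Proof.
move=> w0.
have wP y : \sum_x w x * P x y = \sum_x w x * (P x y - eps).
  under [RHS]eq_bigr do rewrite mulrBr.
  by rewrite sumrB -mulr_suml w0 mul0r subr0.
have le1 : \sum_y `|\sum_x w x * P x y|
    <= (1 - #|Y|%:R * eps) * \sum_y `|w y|.
  apply: (@le_trans _ _ (\sum_y \sum_x `|w x| * (P x y - eps))).
    apply: ler_sum => y _; rewrite wP; apply: le_trans (ler_norm_sum _ _ _) _.
    by apply: ler_sum => x _; rewrite normrM [`|P x y - _|]ger0_norm ?subr_ge0.
  rewrite exchange_big /= mulr_sumr; apply: ler_sum => x _.
  rewrite -mulr_sumr sumrB P_sum sumr_const mulrC ler_wpM2r //.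
  by rewrite -[_ *+ _]mulr_natl.
have le2 : \sum_y `|w y| <= \sum_y `|w y - \sum_x w x * P x y|
    + \sum_y `|\sum_x w x * P x y|.
  rewrite -big_split; apply: ler_sum => y _ /=.
  by rewrite -{1}[w y](subrK (\sum_x w x * P x y)) ler_normD.
by rewrite mulrBl mul1r in le1; lra.
Qed.

(** For a square system, uniqueness of solutions gives existence, for the
    matrix and for its transpose. *)
Lemma square_system (K : Y -> Y -> R) :
  (forall w, (forall y, \sum_x w x * K x y = 0) -> forall x, w x = 0) ->
  (forall f, exists w, forall y, \sum_x w x * K x y = f y) /\
  (forall f, exists g, forall x, \sum_y K x y * g y = f x).
Proof.
move=> Kinj; pose A : 'M[R]_#|Y| := \matrix_(i, j) K (enum_val i) (enum_val j).
have sumE (F : Y -> R) : \sum_y F y = \sum_(i < #|Y|) F (enum_val i).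
  by rewrite (reindex (@enum_val Y Y)) //=; exact: onW_bij (enum_val_bij _).
have Au : A \in unitmx.
  rewrite -row_free_unit; apply/row_freeP.
  have kerA : kermx A = 0.
    apply/row_matrixP => i; rewrite row0.
    have := row_sub i (kermx A); move: (row i _) => v /sub_kermxP vA.
    apply/rowP => j; rewrite mxE -[j]enum_valK.
    apply: (Kinj (fun y => v 0 (enum_rank y))) => y.
    have /matrixP/(_ 0 (enum_rank y)) := vA; rewrite !mxE sumE => vA0.
    rewrite -[RHS]vA0; apply: eq_bigr => k _.
    by rewrite !mxE enum_valK enum_rankK.
  by apply/row_freeP; rewrite -kermx_eq0 kerA.
split=> f.
  pose v := (\row_j f (enum_val j)) *m invmx A.
  exists (fun y => v 0 (enum_rank y)) => y.
  have /matrixP/(_ 0 (enum_rank y)) : v *m A = \row_j f (enum_val j).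
    by rewrite /v mulmxKV.
  rewrite !mxE enum_rankK sumE => <-; apply: eq_bigr => k _.
  by rewrite [A k _]mxE enum_valK enum_rankK.
pose v := invmx A *m (\col_j f (enum_val j)).
exists (fun y => v (enum_rank y) 0) => x.
have /matrixP/(_ (enum_rank x) 0) : A *m v = \col_j f (enum_val j).
  by rewrite /v mulKVmx.
rewrite !mxE enum_rankK sumE => <-; apply: eq_bigr => k _.
by rewrite [A _ k]mxE enum_valK enum_rankK.
Qed.

Variable y0 : Y.

Let cardY_gt0 : 0 < #|Y|%:R :> R.
Proof. by rewrite ltr0n; apply/card_gt0P; exists y0. Qed.

(* Adding 1 to the entries of [I - P] makes it injective. *)
Let K x y := (x == y)%:R - P x y + 1.

Let rowK (w : Y -> R) y :
  \sum_x w x * K x y = w y - \sum_x w x * P x y + \sum_x w x.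
Proof.
under eq_bigr do rewrite /K mulrDr mulrBr mulr1.
rewrite big_split /= sumrB; congr (_ - _ + _).
rewrite (bigD1 y) //= eqxx mulr1 big1 ?addr0 // => x /negPf ->.
by rewrite mulr0.
Qed.

Let sum_rowK (w : Y -> R) :
  \sum_y \sum_x w x * K x y = #|Y|%:R * \sum_x w x.
Proof.
under eq_bigr do rewrite rowK.
rewrite big_split sumrB /= exchange_big /=.
under [X in _ - X + _]eq_bigr do rewrite -mulr_sumr P_sum mulr1.
by rewrite subrr add0r sumr_const mulr_natl.
Qed.

Let K_inj (w : Y -> R) : (forall y, \sum_x w x * K x y = 0) -> forall x, w x = 0.
Proof.
move=> wK; have sw : \sum_x w x = 0.
  apply: (mulfI (lt0r_neq0 cardY_gt0)).
  by rewrite -sum_rowK mulr0 big1 // => y _; exact: wK.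
have := doeblin_contraction sw; rewrite [X in _ <= X]big1; last first.
  by move=> y _; have := wK y; rewrite rowK sw addr0 => ->; rewrite normr0.
rewrite pmulr_rle0 ?mulr_gt0 // => le0 x.
have /eqP : \sum_y `|w y| = 0 by apply/eqP; rewrite eq_le le0 sumr_ge0.
by rewrite psumr_eq0 // => /allP/(_ x (mem_index_enum x)); rewrite normr_eq0 => /eqP.
Qed.

(** The absolute value of a fixed row vector is fixed as well, because it can
    only grow under [P] while its total mass is preserved. *)
Lemma stationary_exists : exists mu, is_stationary P mu.
Proof.
have [/(_ (fun=> 1))[v vK] _] := square_system K_inj.
have sv : \sum_y v y = 1.
  apply: (mulfI (lt0r_neq0 cardY_gt0)); rewrite -sum_rowK mulr1.
  by under eq_bigr do rewrite vK; rewrite sumr_const.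
have vP y : v y = \sum_x v x * P x y.
  by have := vK y; rewrite rowK sv; lra.
have P_ge0 x y : 0 <= P x y by apply: le_trans (P_ge x y); exact: ltW.
have le1 y : `|v y| <= \sum_x `|v x| * P x y.
  rewrite vP; apply: le_trans (ler_norm_sum _ _ _) _.
  by apply: ler_sum => x _; rewrite normrM (ger0_norm (P_ge0 _ _)).
have eq1 y : \sum_x `|v x| * P x y = `|v y|.
  have /eqP : \sum_y (\sum_x `|v x| * P x y - `|v y|) = 0.
    rewrite sumrB exchange_big /=; apply/eqP; rewrite subr_eq0; apply/eqP.
    by apply: eq_bigr => x _; rewrite -mulr_sumr P_sum mulr1.
  rewrite psumr_eq0 => [/allP/(_ y (mem_index_enum y))|z _].
    by rewrite subr_eq0 => /eqP.
  by rewrite subr_ge0.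
have S_gt0 : 0 < \sum_y `|v y|.
  by apply: lt_le_trans (ler_norm_sum _ _ _); rewrite sv normr1.
exists (fun y => `|v y| / \sum_y `|v y|); split; first split.
- by move=> y; rewrite divr_ge0 // ltW.
- by rewrite -mulr_suml divff // lt0r_neq0.
- move=> y; under eq_bigr do rewrite mulrAC.
  by rewrite -mulr_suml eq1.
Qed.

(** The Poisson equation: it makes the deviation of [f] from its stationary
    mean a telescoping term plus a martingale increment. *)
Lemma poisson_equation (mu f : Y -> R) : is_stationary P mu ->
  exists g : Y -> R, forall x,
    f x + \sum_y P x y * g y - g x = \sum_y mu y * f y.
Proof.
move=> [[mu_ge0 mu1] muP]; have [_ /(_ f)[g gK]] := square_system K_inj.
have colK x : \sum_y K x y * g y = g x - \sum_y P x y * g y + \sum_y g y.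
  under eq_bigr do rewrite /K mulrDl mulrBl mul1r.
  rewrite big_split /= sumrB; congr (_ - _ + _).
  rewrite (bigD1 x) //= eqxx mul1r big1 ?addr0 // => y; rewrite eq_sym => /negPf ->.
  by rewrite mul0r.
have sg : \sum_y g y = \sum_y mu y * f y.
  under [RHS]eq_bigr do rewrite -gK mulr_sumr.
  rewrite exchange_big /=; apply: eq_bigr => y _.
  under eq_bigr do rewrite mulrA.
  by rewrite -mulr_suml rowK muP mu1 subrr add0r mul1r.
by exists g => x; rewrite -sg -gK colK; ring.
Qed.

End PositiveKernel.

(** * Expectations over finite histories *)

Section Words.
Variable A : finType.

Fixpoint words (n : nat) : seq (seq A) :=
  if n is m.+1 then [seq rcons h z | h <- words m, z <- enum A] else [:: [::]].

Lemma mem_words n h : (h \in words n) = (size h == n).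
Proof.
elim: n h => [|n IH] h /=; first by rewrite inE size_eq0.
apply/allpairsP/idP => [[[g z] /= [+ _ ->]]|].
  by rewrite IH size_rcons eqSS.
case/lastP: h => [//|h z]; rewrite size_rcons eqSS => hn.
by exists (h, z); rewrite /= IH hn mem_enum.
Qed.

Lemma words_uniq n : uniq (words n).
Proof.
elim: n => //= n IH; apply: allpairs_uniq => //; first exact: enum_uniq.
by move=> [g z] [g' z'] _ _ /= /rcons_inj[-> ->].
Qed.

Lemma big_words_S (R : realType) n (F : seq A -> R) :
  \sum_(h <- words n.+1) F h = \sum_(h <- words n) \sum_z F (rcons h z).
Proof.
by rewrite /= big_allpairs_dep; apply: eq_bigr => h _; rewrite big_enum.
Qed.

Lemma prod_rcons (R : realType) (G : seq A -> A -> R) h z :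
  \prod_(k < size (rcons h z))
     G (take k (rcons h z)) (tnth (in_tuple (rcons h z)) k)
  = (\prod_(k < size h) G (take k h) (tnth (in_tuple h) k)) * G h z.
Proof.
have prodE g : \prod_(k < size g) G (take k g) (tnth (in_tuple g) k)
    = \prod_(0 <= k < size g) G (take k g) (nth z g k).
  by rewrite big_mkord; apply: eq_bigr => k _; rewrite (tnth_nth z).
rewrite !prodE size_rcons big_nat_recr //= nth_rcons ltnn eqxx.
rewrite -cats1 take_size_cat //; congr (_ * _).
apply: eq_big_nat => k /= kh; rewrite nth_cat kh.
by rewrite take_cat kh.
Qed.

(** A history is extended until it first satisfies [S] and is then frozen:
    [stopped S] is the process stopped at the hitting time of [S]. *)
Definition stopped (S : pred (seq A)) (h : seq A) : seq A :=
  foldl (fun g z => if S g then g else rcons g z) [::] h.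

Lemma stopped_rcons S h z : stopped S (rcons h z) =
  if S (stopped S h) then stopped S h else rcons (stopped S h) z.
Proof. by rewrite /stopped foldl_rcons. Qed.

Lemma stopped_id S h : ~~ S (stopped S h) -> stopped S h = h.
Proof.
elim/last_ind: h => // h z IH; rewrite stopped_rcons.
by case: ifPn => [->//|/IH ->].
Qed.

Lemma stopped_running S h :
  stopped S h = [::] \/
  exists g z, stopped S h = rcons g z /\ ~~ S g.
Proof.
elim/last_ind: h => [|h z IH]; first by left.
rewrite stopped_rcons; case: ifPn => // Sh; right.
by exists (stopped S h), z.
Qed.

End Words.

Section Expectation.
Variables (R : realType) (Y U : finType) (M : nat).
Variables (p : 'I_M -> U -> Y -> Y -> R) (y0 : Y).
Hypothesis p_pmf : forall i u yt, is_pmf (p i u yt).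
Hypothesis p_gt0 : forall i u yt y, 0 < p i u yt y.
Local Notation hst := (seq (Y * U)).

Lemma last_obs_rcons (h : hst) z : last_obs y0 (rcons h z) = z.1.
Proof. by rewrite /last_obs map_rcons last_rcons. Qed.

(** The two factors of the joint pmf: the first does not involve the policy,
    the second does not involve the hypothesis. *)
Definition lik i (h : hst) : R :=
  \prod_(k < size h) p i (tnth (in_tuple h) k).2 (last_obs y0 (take k h))
                         (tnth (in_tuple h) k).1.

Definition pol_weight (phi : hst -> U -> R) (h : hst) : R :=
  \prod_(k < size h) phi (take k h) (tnth (in_tuple h) k).2.

Lemma joint_pmfE phi i h : joint_pmf p y0 phi i h = lik i h * pol_weight phi h.
Proof. by []. Qed.

Lemma lik_rcons i h z :
  lik i (rcons h z) = lik i h * p i z.2 (last_obs y0 h) z.1.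
Proof. exact: (prod_rcons (fun g z => p i z.2 (last_obs y0 g) z.1)). Qed.

Lemma lik_nil i : lik i [::] = 1.
Proof. by rewrite /lik big_ord0. Qed.

Lemma lik_gt0 i h : 0 < lik i h.
Proof. by apply: prodr_gt0 => k _; exact: p_gt0. Qed.

Lemma pol_weight_rcons phi h z :
  pol_weight phi (rcons h z) = pol_weight phi h * phi h z.2.
Proof. exact: (prod_rcons (fun g z => phi g z.2)). Qed.

Lemma pol_weight_nil phi : pol_weight phi [::] = 1.
Proof. by rewrite /pol_weight big_ord0. Qed.

(** Conditional expectation of [F] at the next history, given the present one. *)
Definition step (phi : hst -> U -> R) i (F : hst -> R) (h : hst) : R :=
  \sum_u phi h u * \sum_y p i u (last_obs y0 h) y * F (rcons h (y, u)).

Definition expect (phi : hst -> U -> R) i n (F : hst -> R) : R :=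
  \sum_(h <- words (Y * U)%type n) joint_pmf p y0 phi i h * F h.

Lemma expect0 phi i F : expect phi i 0 F = F [::].
Proof.
by rewrite /expect /= big_seq1 joint_pmfE lik_nil pol_weight_nil !mul1r.
Qed.

Lemma expectS phi i n F : expect phi i n.+1 F = expect phi i n (step phi i F).
Proof.
rewrite /expect big_words_S; apply: eq_bigr => h _.
pose G y u := joint_pmf p y0 phi i (rcons h (y, u)) * F (rcons h (y, u)).
rewrite (eq_bigr (fun z => G z.1 z.2)); last by case.
rewrite -(pair_bigA _ G) exchange_big /step mulr_sumr; apply: eq_bigr => u _.
rewrite !mulr_sumr; apply: eq_bigr => y _.
rewrite /G !joint_pmfE lik_rcons pol_weight_rcons [snd _]/= [fst _]/=.
by move: (lik i h) (pol_weight phi h) (phi h u) (F _) (p _ _ _ _) => l w v f q; ring.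
Qed.

Lemma expectD phi i n F G :
  expect phi i n (fun h => F h + G h) = expect phi i n F + expect phi i n G.
Proof. by rewrite /expect -big_split /=; apply: eq_bigr => h _; rewrite mulrDr. Qed.

Lemma expectZ phi i n a F :
  expect phi i n (fun h => a * F h) = a * expect phi i n F.
Proof. by rewrite /expect mulr_sumr; apply: eq_bigr => h _; rewrite mulrCA. Qed.

Lemma expectB phi i n F G :
  expect phi i n (fun h => F h - G h) = expect phi i n F - expect phi i n G.
Proof. by rewrite /expect -sumrB /=; apply: eq_bigr => h _; rewrite mulrBr. Qed.

Lemma expect_sum phi i n (I : Type) (r : seq I) (P : pred I) (F : I -> hst -> R) :
  expect phi i n (fun h => \sum_(k <- r | P k) F k h)
    = \sum_(k <- r | P k) expect phi i n (F k).
Proof.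
rewrite /expect exchange_big; apply: eq_bigr => h _.
by rewrite mulr_sumr.
Qed.

Lemma eq_expect phi i n F G : (forall h, size h = n -> F h = G h) ->
  expect phi i n F = expect phi i n G.
Proof.
move=> FG; rewrite /expect; apply: eq_big_seq => h.
by rewrite mem_words => /eqP /FG ->.
Qed.

Section Policy.
Variable phi : hst -> U -> R.
Hypothesis phiP : is_policy phi.

Lemma pol_weight_ge0 h : 0 <= pol_weight phi h.
Proof. by apply: prodr_ge0 => k _; have [] := phiP (take k h). Qed.

Lemma joint_pmf_ge0 i h : 0 <= joint_pmf p y0 phi i h.
Proof. by rewrite joint_pmfE mulr_ge0 ?pol_weight_ge0 // ltW ?lik_gt0. Qed.

Lemma pol_weight_gt0_rcons h z :
  0 < pol_weight phi (rcons h z) -> 0 < pol_weight phi h.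
Proof.
rewrite pol_weight_rcons !lt0r mulf_eq0 negb_or => /andP[/andP[-> _] _].
exact: pol_weight_ge0.
Qed.

Lemma pol_weight_gt0_stopped S h :
  0 < pol_weight phi h -> 0 < pol_weight phi (stopped S h).
Proof.
elim/last_ind: h => // h z IH; rewrite stopped_rcons => hz.
have := IH (pol_weight_gt0_rcons hz).
by case: ifPn => // /stopped_id ->.
Qed.

Lemma le_expect i n F G :
  (forall h, size h = n -> 0 < pol_weight phi h -> F h <= G h) ->
  expect phi i n F <= expect phi i n G.
Proof.
move=> FG; rewrite /expect big_seq [X in _ <= X]big_seq.
apply: ler_sum => h; rewrite mem_words => /eqP hn.
have [h0|] := ltP 0 (pol_weight phi h).
  by rewrite ler_wpM2l ?joint_pmf_ge0 ?FG.
move=> h0; have /eqP h0' : pol_weight phi h == 0 by rewrite eq_le h0 pol_weight_ge0.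
by rewrite joint_pmfE h0' mulr0 !mul0r.
Qed.

Lemma expect_ge0 i n F : (forall h, 0 <= F h) -> 0 <= expect phi i n F.
Proof. by move=> F0; apply: sumr_ge0 => h _; rewrite mulr_ge0 ?joint_pmf_ge0. Qed.

Lemma step_cst i a h : step phi i (fun=> a) h = a.
Proof.
rewrite /step; under eq_bigr do rewrite -mulr_suml (p_pmf _ _ _).2 mul1r.
by rewrite -mulr_suml (phiP h).2 mul1r.
Qed.

Lemma expect_cst i n a : expect phi i n (fun=> a) = a.
Proof.
elim: n => [|n IH]; first by rewrite expect0.
by rewrite expectS -[RHS]IH; apply: eq_expect => h _; rewrite step_cst.
Qed.

Lemma le_step i F G h :
  (forall y u, 0 < phi h u -> F (rcons h (y, u)) <= G (rcons h (y, u))) ->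
  step phi i F h <= step phi i G h.
Proof.
move=> FG; apply: ler_sum => u _; have [phi0 _] := phiP h.
have := phi0 u; rewrite le_eqVlt => /predU1P[<-|u0]; first by rewrite !mul0r.
by rewrite ler_pM2l //; apply: ler_sum => y _; rewrite ler_pM2l // FG.
Qed.

Lemma stepD i F G h :
  step phi i (fun g => F g + G g) h = step phi i F h + step phi i G h.
Proof.
rewrite /step -big_split /=; apply: eq_bigr => u _; rewrite -mulrDr.
by congr (_ * _); rewrite -big_split; apply: eq_bigr => y _; rewrite mulrDr.
Qed.

Lemma stepZ i a F h : step phi i (fun g => a * F g) h = a * step phi i F h.
Proof.
rewrite /step mulr_sumr; apply: eq_bigr => u _; rewrite mulrCA; congr (_ * _).
by rewrite mulr_sumr; apply: eq_bigr => y _; rewrite mulrCA.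
Qed.

(** Dynkin's formula: the stopped process moves by one [step] at the times at
    which it is still running, and stays put afterwards. *)
Lemma expect_stopped S i n F :
  expect phi i n (F \o stopped S) = F [::] +
    \sum_(k < n) expect phi i k
      (fun h => (~~ S (stopped S h))%:R * (step phi i F h - F h)).
Proof.
elim: n => [|n IH]; first by rewrite expect0 big_ord0 addr0.
rewrite expectS big_ord_recr /= addrA -IH -expectD.
apply: eq_expect => h _ /=.
transitivity (if S (stopped S h) then F (stopped S h) else step phi i F h).
  case: ifPn => [Sh|/[dup] /stopped_id {2}<- Sh].
    rewrite -[RHS](step_cst i _ h) /step; apply: eq_bigr => u _.
    by congr (_ * _); apply: eq_bigr => y _; rewrite /= stopped_rcons Sh.
  rewrite /step (stopped_id Sh); apply: eq_bigr => u _.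
  congr (_ * _); apply: eq_bigr => y _.
  by rewrite /= stopped_rcons (negPf Sh) stopped_id.
case: ifPn => [_|/stopped_id ->]; first by rewrite mul0r addr0.
by rewrite mul1r addrC subrK.
Qed.

(** The policy is common to both hypotheses, so it cancels in the density of
    the law under [j] with respect to the law under [i]; by optional stopping
    this density may be taken at the stopped history. *)
Lemma change_of_measure S i j n F :
  expect phi i n
    (fun h => lik j (stopped S h) / lik i (stopped S h) * F (stopped S h))
  = expect phi j n (F \o stopped S).
Proof.
elim: n F => [|n IH] F; first by rewrite !expect0 /= !lik_nil divr1 mul1r.
pose F1 h := if S h then F h else step phi j F h.
have E_j : expect phi j n.+1 (F \o stopped S) = expect phi j n (F1 \o stopped S).
  rewrite expectS; apply: eq_expect => h _; rewrite /F1 /=.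
  case: ifPn => [Sh|Sh].
    rewrite -[RHS](step_cst j _ h) /step; apply: eq_bigr => u _.
    by congr (_ * _); apply: eq_bigr => y _; rewrite /= stopped_rcons Sh.
  rewrite (stopped_id Sh) /step; apply: eq_bigr => u _; congr (_ * _).
  by apply: eq_bigr => y _; rewrite /= stopped_rcons (negPf Sh) stopped_id.
rewrite E_j -IH expectS; apply: eq_expect => h _; rewrite /F1.
case: ifPn => [Sh|Sh].
  rewrite -[RHS](step_cst i _ h) /step; apply: eq_bigr => u _.
  by congr (_ * _); apply: eq_bigr => y _; rewrite /= stopped_rcons Sh.
rewrite (stopped_id Sh) /step mulr_sumr; apply: eq_bigr => u _.
rewrite [RHS]mulrCA; congr (_ * _); rewrite mulr_sumr; apply: eq_bigr => y _.
rewrite stopped_rcons (negPf Sh) stopped_id // !lik_rcons /=.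
move: (lt0r_neq0 (lik_gt0 i h)) (lt0r_neq0 (p_gt0 i u (last_obs y0 h) y)).
move: (lik i h) (lik j h) (F _) (p i _ _ _) (p j _ _ _) => l l' f q q' l0 q0.
by field; rewrite q0 l0.
Qed.

End Policy.
End Expectation.

(** * Stationary rates and the value of the optimal policy *)

Lemma ln_le_sub1 (R : realType) (x : R) : 0 < x -> ln x <= x - 1.
Proof.
by move=> x0; rewrite -{1}(subrKC 1 x) le_ln1Dx // ltrBrDr addrC subrr.
Qed.

Lemma KL_ge0 (R : realType) (T : finType) (f g : T -> R) :
  is_pmf f -> is_pmf g -> (forall x, 0 < f x) -> (forall x, 0 < g x) ->
  0 <= KL f g.
Proof.
move=> [_ f1] [_ g1] f0 g0.
have -> : 0 = \sum_x (f x - g x) by rewrite sumrB f1 g1 subrr.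
apply: ler_sum => x _.
rewrite -[f x / g x]invrK lnV ?posrE ?invr_gt0 ?divr_gt0 // invf_div.
have le1 : f x * ln (g x / f x) <= f x * (g x / f x - 1).
  by rewrite ler_pM2l // ln_le_sub1 // divr_gt0.
rewrite mulrBr mulr1 mulrCA divff ?lt0r_neq0 // mulr1 in le1.
by rewrite mulrN lerNr opprB.
Qed.

Lemma fin_bound (R : realType) (T : finType) (f : T -> R) :
  exists2 B : R, 0 <= B & forall x, `|f x| <= B.
Proof.
exists (\sum_x `|f x|); first by rewrite sumr_ge0.
by move=> x; rewrite (bigD1 x) //= lerDl sumr_ge0.
Qed.

Lemma fin_lower_bound (R : realType) (T : finType) (f : T -> R) :
  (forall x, 0 < f x) -> exists2 e : R, 0 < e & forall x, e <= f x.
Proof.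
move=> f0; exists (\big[Num.min/1]_x f x); last by move=> x; exact: bigmin_le.
by apply: lt_bigmin => // x _; exact: f0.
Qed.

Section Rates.
Variables (R : realType) (Y U : finType) (M : nat).
Variables (p : 'I_M -> U -> Y -> Y -> R) (y0 : Y) (c : U -> R).
Hypothesis p_pmf : forall i u yt, is_pmf (p i u yt).
Hypothesis p_gt0 : forall i u yt y, 0 < p i u yt y.
Hypothesis c_gt0 : forall u, 0 < c u.

Lemma kernel_lower_bound : exists2 e : R, 0 < e & forall i u yt y, e <= p i u yt y.
Proof.
have [e e0 pe] := @fin_lower_bound R ('I_M * U * Y * Y)%type
  (fun x => p x.1.1.1 x.1.1.2 x.1.2 x.2) (fun x => p_gt0 _ _ _ _).
by exists e => // i u yt y; exact: (pe (i, u, yt, y)).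
Qed.

Section Mixed.
Variables (i : 'I_M) (q : Y -> U -> R) (e : R).
Hypotheses (qP : is_cond_pmf q) (e_gt0 : 0 < e).
Hypothesis p_ge : forall i u yt y, e <= p i u yt y.

Lemma mixed_kernel_ge x y : e <= mixed_kernel p i q x y.
Proof.
rewrite -[e]mul1r -(qP x).2 mulr_suml; apply: ler_sum => u _.
by rewrite ler_wpM2l // (qP x).1.
Qed.

Lemma mixed_kernel_sum x : \sum_y mixed_kernel p i q x y = 1.
Proof.
rewrite /mixed_kernel exchange_big /= -(qP x).2; apply: eq_bigr => u _.
by rewrite -mulr_sumr (p_pmf _ _ _).2 mulr1.
Qed.

End Mixed.

Lemma stat_distP i q : is_cond_pmf q ->
  is_stationary (mixed_kernel p i q) (stat_dist p i q).
Proof.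
move=> qP; have [e e0 pe] := kernel_lower_bound.
have [mu mu_st] := stationary_exists e0 (mixed_kernel_ge i qP pe)
  (mixed_kernel_sum i qP) y0.
by rewrite /stat_dist; case: xgetP => [nu _ //|/(_ mu)].
Qed.

Lemma cost_rate_gt0 i q : is_cond_pmf q -> 0 < cost_rate p c q i.
Proof.
move=> qP; have [[mu0 mu1] _] := stat_distP i qP.
have [e e0 ce] := fin_lower_bound c_gt0.
apply: (lt_le_trans e0); rewrite -[e]mul1r -mu1 mulr_suml.
apply: ler_sum => y _; rewrite -[e]mul1r -(qP y).2 mulrA mulr_sumr mulr_suml.
apply: ler_sum => u _; rewrite ler_wpM2l // mulr_ge0 //.
by have [] := qP y.
Qed.

Lemma info_rate_ge0 i j q : is_cond_pmf q -> 0 <= info_rate p q i j.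
Proof.
move=> qP; have [[mu0 mu1] _] := stat_distP i qP.
apply: sumr_ge0 => y _; apply: sumr_ge0 => u _.
by rewrite mulr_ge0 ?KL_ge0 // mulr_ge0 //; have [] := qP y.
Qed.

Lemma reward_attained i q : (1 < M)%N -> is_cond_pmf q ->
  exists j, [/\ j != i, reward p c i q = (info_rate p q i j / cost_rate p c q i)%:E
    & forall k, k != i -> info_rate p q i j <= info_rate p q i k].
Proof.
move=> M1 qP.
have [j0 j0i] : exists j0 : 'I_M, j0 != i.
  have M0 : (0 < M)%N by apply: ltnW.
  have [i0|i0] := eqVneq i (Ordinal M0).
    by exists (Ordinal M1); rewrite i0.
  by exists (Ordinal M0); rewrite eq_sym.
have [|j ji jE] := eq_bigmin (x := +oo%E) j0 [pred j | j != i]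
    (fun j => (info_rate p q i j)%:E) j0i.
  by move=> *; rewrite leey.
exists j; split=> //.
  by rewrite /reward jE inver gt_eqF ?cost_rate_gt0.
move=> k ki; rewrite -lee_fin -jE.
exact: (@bigmin_le_cond _ _ _ _ k [pred j | j != i] (fun j => (info_rate p q i j)%:E)).
Qed.

(** The cost rate is positive and, as there are at least two hypotheses, the
    minimum over the alternatives is attained; hence [dstar] is a real number,
    and its attainment and its maximality can be stated without division. *)
Lemma dstar_value i qs : (1 < M)%N -> attains_dstar p c i qs ->
  exists d : R, [/\ 0 <= d, dstar p c i = d%:E,
    forall k, k != i -> d * cost_rate p c qs i <= info_rate p qs i k &
    forall q, is_cond_pmf q -> exists2 j, j != i &
      info_rate p q i j <= d * cost_rate p c q i].
Proof.
move=> M1 [qsP rqs]; have [j [ji rj jmin]] := reward_attained i M1 qsP.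
exists (info_rate p qs i j / cost_rate p c qs i); split.
- by rewrite divr_ge0 ?info_rate_ge0 // ltW // cost_rate_gt0.
- by rewrite -rqs.
- by move=> k ki; rewrite divfK ?jmin // gt_eqF // cost_rate_gt0.
- move=> q qP; have [k [ki rk kmin]] := reward_attained i M1 qP; exists k => //.
  rewrite -ler_pdivrMr ?cost_rate_gt0 // -lee_fin -rk -rj rqs.
  by apply: ereal_sup_ubound; exists q.
Qed.

(** If the kernels coincided, all Kullback-Leibler distances would be 0. *)
Lemma info_rate_gt0_neq i j q : is_cond_pmf q -> 0 < info_rate p q i j ->
  exists u yt y, p i u yt y != p j u yt y.
Proof.
move=> qP; apply: contraPP => /forallNP pij.
have {}pij u yt y : p i u yt y = p j u yt y.
  by apply/eqP/negPn/negP => neq; apply: (pij u); exists yt, y.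
rewrite /info_rate big1 ?ltxx // => y _; apply: big1 => u _.
by rewrite /KL big1 ?mulr0 // => z _; rewrite pij divff ?ln1 ?mulr0 // gt_eqF.
Qed.

(** A nonnegative measure on state-control pairs whose flow is balanced up to
    1 in each state is, up to a bounded error, a multiple of the stationary
    measure of the conditional pmf that it induces: the difference of the two
    has total mass 0, and is almost fixed by a kernel that contracts such
    vectors. *)
Lemma occupation_measure i (e : R) (occ : Y -> U -> R) (q0 : Y -> U -> R) :
  0 < e -> (forall i u yt y, e <= p i u yt y) -> is_cond_pmf q0 ->
  (forall y u, 0 <= occ y u) ->
  (forall y', `|\sum_y \sum_u occ y u * (p i u y y' - (y == y')%:R)| <= 1) ->
  exists2 q, is_cond_pmf q & exists2 n : R, 0 <= n &
    forall (f : Y -> U -> R) B, (forall y u, `|f y u| <= B) ->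
    `|\sum_y \sum_u occ y u * f y u
      - n * \sum_y \sum_u stat_dist p i q y * q y u * f y u| <= B / e.
Proof.
move=> e0 pe q0P occ0 balance.
pose nu y := \sum_u occ y u; pose n := \sum_y nu y.
have nu0 y : 0 <= nu y by exact: sumr_ge0.
pose q y u := if nu y == 0 then q0 y u else occ y u / nu y.
have occE y u : occ y u = nu y * q y u.
  rewrite /q; case: eqP => [nu_y|/eqP nu_y]; last by rewrite mulrC divfK.
  rewrite nu_y mul0r; move/eqP: nu_y; rewrite psumr_eq0 //.
  by move=> /allP/(_ u (mem_index_enum u)) /eqP.
have qP : is_cond_pmf q.
  move=> y; rewrite /q; case: eqP => [_|/eqP nu_y]; first exact: q0P.
  split=> [u|]; first by rewrite divr_ge0.
  by rewrite -mulr_suml divff.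
exists q => //; exists n; first exact: sumr_ge0.
have [[mu0 mu1] muP] := stat_distP i qP; set mu := stat_dist p i q in mu0 mu1 muP *.
pose w y := n * mu y - nu y.
have sw : \sum_y w y = 0 by rewrite sumrB -mulr_sumr mu1 mulr1 subrr.
have wK y' : w y' - \sum_x w x * mixed_kernel p i q x y' =
    \sum_y \sum_u occ y u * (p i u y y' - (y == y')%:R).
  have -> : \sum_x w x * mixed_kernel p i q x y' = n * mu y'
      - \sum_x nu x * mixed_kernel p i q x y'.
    by rewrite -muP mulr_sumr -sumrB; apply: eq_bigr => x _; rewrite mulrBl mulrA.
  have -> : \sum_y \sum_u occ y u * (p i u y y' - (y == y')%:R) =
      \sum_x nu x * mixed_kernel p i q x y' - nu y'.
    have -> : nu y' = \sum_y nu y * (y == y')%:R.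
      by rewrite (bigD1 y') //= eqxx mulr1 big1 ?addr0 // => y /negPf ->; rewrite mulr0.
    rewrite -sumrB; apply: eq_bigr => y _.
    rewrite /nu [X in _ - X]mulr_suml -/(nu y) /mixed_kernel mulr_sumr -sumrB.
    by apply: eq_bigr => u _; rewrite mulrBr {1}occE mulrA.
  by rewrite /w; lra.
have card0 : 0 < #|Y|%:R :> R by rewrite ltr0n; apply/card_gt0P; exists y0.
have w_le : \sum_y `|w y| <= e^-1.
  have := doeblin_contraction (mixed_kernel_ge i qP pe) (mixed_kernel_sum i qP) sw.
  have : \sum_y `|w y - \sum_x w x * mixed_kernel p i q x y| <= #|Y|%:R.
    rewrite -[#|Y|]sum1_card natr_sum; apply: ler_sum => y _.
    by rewrite wK.
  move=> /[swap] /le_trans /[apply].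
  rewrite -mulrA -{2}[#|Y|%:R]mulr1 ler_pM2l // => le1.
  by rewrite -(ler_pM2l e0) divff // gt_eqF.
move=> f B fB; rewrite mulrC.
have B0 : 0 <= B.
  have [u _ |U0] := pickP (fun _ : U => true); first exact: le_trans (fB y0 u).
  by have := (qP y0).2; rewrite big_pred0 // => /eqP; rewrite eq_sym oner_eq0.
apply: le_trans (_ : (\sum_y `|w y|) * B <= _); last by rewrite mulrC ler_wpM2l.
have -> : \sum_y \sum_u occ y u * f y u
      - (\sum_y \sum_u mu y * q y u * f y u) * n
    = - \sum_y w y * \sum_u q y u * f y u.
  rewrite mulr_suml -sumrB -sumrN; apply: eq_bigr => y _.
  under eq_bigr do rewrite occE -mulrA.
  under [X in _ - X * n]eq_bigr do rewrite -mulrA.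
  by rewrite -!mulr_sumr /w; move: (\sum_u _) => s; ring.
rewrite normrN mulr_suml; apply: le_trans (ler_norm_sum _ _ _) _.
apply: ler_sum => y _; rewrite normrM ler_wpM2l //.
apply: le_trans (ler_norm_sum _ _ _) _.
rewrite -[B]mul1r -(qP y).2 mulr_suml; apply: ler_sum => u _.
by rewrite normrM (ger0_norm ((qP y).1 u)) ler_wpM2l // (qP y).1.
Qed.

End Rates.

(** * The converse *)

Section Converse.
Variables (R : realType) (Y U : finType) (M : nat).
Variables (p : 'I_M -> U -> Y -> Y -> R) (y0 : Y) (c : U -> R).
Hypothesis p_pmf : forall i u yt, is_pmf (p i u yt).
Hypothesis p_gt0 : forall i u yt y, 0 < p i u yt y.
Local Notation hst := (seq (Y * U)).

Definition llr i j (h : hst) : R := ln (lik p y0 i h / lik p y0 j h).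

Lemma llr_rcons i j h z : llr i j (rcons h z) =
  llr i j h + ln (p i z.2 (last_obs y0 h) z.1 / p j z.2 (last_obs y0 h) z.1).
Proof.
rewrite /llr !lik_rcons -lnM ?posrE ?divr_gt0 ?lik_gt0 //.
by rewrite mulrACA invfM.
Qed.

Lemma llr_nil i j : llr i j [::] = 0.
Proof. by rewrite /llr !lik_nil divff ?oner_eq0 // ln1. Qed.

(** Expected sum of [g] over the histories seen before the stopping time, up
    to the horizon [n]. *)
Definition run_sum (phi : hst -> U -> R) i S n (g : hst -> R) : R :=
  \sum_(k < n) expect p y0 phi i k (fun h => (~~ S (stopped S h))%:R * g h).

Lemma run_sumZ phi i S n a g :
  run_sum phi i S n (fun h => a * g h) = a * run_sum phi i S n g.
Proof.
rewrite /run_sum mulr_sumr; apply: eq_bigr => k _.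
by rewrite -expectZ; apply: eq_expect => h _; rewrite mulrCA.
Qed.

Lemma run_sumD phi i S n f g :
  run_sum phi i S n (fun h => f h + g h)
    = run_sum phi i S n f + run_sum phi i S n g.
Proof.
rewrite /run_sum -big_split; apply: eq_bigr => k _ /=.
by rewrite -expectD; apply: eq_expect => h _; rewrite mulrDr.
Qed.

Lemma eq_run_sum phi i S n f g : f =1 g ->
  run_sum phi i S n f = run_sum phi i S n g.
Proof. by move=> fg; apply: eq_bigr => k _; apply: eq_expect => h _; rewrite fg. Qed.

Section Policy.
Variable phi : hst -> U -> R.
Hypothesis phiP : is_policy phi.

Lemma le_run_sum i S n f g :
  (forall h, 0 < pol_weight phi h -> ~~ S h -> f h <= g h) ->
  run_sum phi i S n f <= run_sum phi i S n g.
Proof.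
move=> fg; apply: ler_sum => k _; apply: le_expect => // h _ h0.
case: (boolP (S _)) => Sh; rewrite ?mul0r // !mul1r fg //.
by rewrite -(stopped_id Sh).
Qed.

Lemma expect_running_decr i S n :
  expect p y0 phi i n.+1 (fun h => (~~ S (stopped S h))%:R) <=
  expect p y0 phi i n (fun h => (~~ S (stopped S h))%:R).
Proof.
rewrite expectS; apply: le_expect => // h _ _.
rewrite -[leRHS](step_cst y0 p_pmf phiP i _ h); apply: le_step => // y u _.
by rewrite stopped_rcons; case: ifPn => [->|_] //; rewrite ler_nat; case: (~~ _).
Qed.

Lemma dynkin S i n F : expect p y0 phi i n (F \o stopped S) =
  F [::] + run_sum phi i S n (fun h => step p y0 phi i F h - F h).
Proof. exact: expect_stopped. Qed.

Lemma step_llr i j h : step p y0 phi i (llr i j) h - llr i j h =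
  \sum_u phi h u * KL (p i u (last_obs y0 h)) (p j u (last_obs y0 h)).
Proof.
rewrite -[X in _ - X](step_cst y0 p_pmf phiP i _ h) /step -sumrB.
apply: eq_bigr => u _; rewrite -mulrBr -sumrB; congr (_ * _).
by apply: eq_bigr => y _; rewrite llr_rcons -mulrBr addrAC subrr add0r.
Qed.

Lemma step_obs i (g : Y -> R) h :
  step p y0 phi i (g \o last_obs y0) h - g (last_obs y0 h) =
  \sum_u phi h u *
    (\sum_y p i u (last_obs y0 h) y * g y - g (last_obs y0 h)).
Proof.
rewrite -[X in _ - X](step_cst y0 p_pmf phiP i _ h) /step -sumrB.
apply: eq_bigr => u _; rewrite -mulrBr; congr (_ * (_ - _)).
  by apply: eq_bigr => y _; rewrite /= last_obs_rcons.
by rewrite -mulr_suml (p_pmf _ _ _).2 mul1r.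
Qed.

(** [1 + x <= expR x] at [x = s 1_D - llr i j] and a change of measure bound
    the expected log-likelihood ratio from below by what it takes to make the
    event [D] likely under [i] and unlikely under [j]. *)
Lemma data_processing S (D : pred hst) i j n s :
  0 <= s ->
  expR s * expect p y0 phi j n (fun h => (D (stopped S h))%:R) <= 1 ->
  s * expect p y0 phi i n (fun h => (D (stopped S h))%:R) <=
    expect p y0 phi i n (llr i j \o stopped S) + 1.
Proof.
move=> s0 sD.
pose G h := expR (s * (D h)%:R).
have EG : expect p y0 phi j n (G \o stopped S) <= 2.
  apply: (@le_trans _ _ (expect p y0 phi j n
      (fun h => 1 + expR s * (D (stopped S h))%:R))).
    apply: le_expect => // h _ _; rewrite /G /=; case: (D _) => /=.
      by rewrite !mulr1 lerDr.
    by rewrite !mulr0 expR0 addr0.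
  by rewrite expectD expectZ expect_cst //; lra.
rewrite -(change_of_measure y0 p_pmf p_gt0 phiP S i) in EG.
have : expect p y0 phi i n
    (fun h => 1 + (s * (D (stopped S h))%:R - llr i j (stopped S h))) <= 2.
  apply: le_trans EG; apply: le_expect => // h _ _.
  apply: le_trans (expR_ge1Dx _) _; rewrite /G expRB mulrC /llr.
  by rewrite lnK ?posrE ?divr_gt0 ?lik_gt0 // invf_div.
by rewrite expectD expect_cst // expectB expectZ /comp; lra.
Qed.

End Policy.

(** The expected log-likelihood ratio and the expected cost at the stopping
    time are both linear in the occupation measure [occ] of the stopped process;
    replacing it by a stationary measure changes both by at most a constant that
    depends neither on the test nor on the horizon. *)
Lemma converse_finite i qs : (1 < M)%N -> attains_dstar p c i qs ->
  (forall u, 0 < c u) -> exists2 C : R, 0 <= C &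
  forall phi, is_policy phi -> forall S (D : pred hst) n s, 0 <= s ->
  (forall j, j != i ->
     expR s * expect p y0 phi j n (fun h => (D (stopped S h))%:R) <= 1) ->
  s * expect p y0 phi i n (fun h => (D (stopped S h))%:R) <=
    fine (dstar p c i) * run_sum phi i S n (fun h => \sum_u phi h u * c u) + C.
Proof.
move=> M1 qsP c_gt0.
have [d [d0 dE _ dmax]] := dstar_value y0 p_pmf p_gt0 c_gt0 M1 qsP.
rewrite dE /=; have [e e0 pe] := kernel_lower_bound p_gt0.
have [B1 B1_ge0 KLB] := @fin_bound R ('I_M * Y * U)%type
  (fun x => KL (p i x.2 x.1.2) (p x.1.1 x.2 x.1.2)).
have [B2 B2_ge0 cB] := fin_bound c.
exists (B1 / e + d * (B2 / e) + 1).
  by rewrite !addr_ge0 ?mulr_ge0 ?invr_ge0 // ltW.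
move=> phi phiP S D n s s0 sD.
pose occ y u := run_sum phi i S n (fun h => (last_obs y0 h == y)%:R * phi h u).
have occE f : run_sum phi i S n (fun h => \sum_u phi h u * f (last_obs y0 h) u)
    = \sum_y \sum_u occ y u * f y u.
  under [RHS]eq_bigr do under eq_bigr do
    rewrite mulrC -run_sumZ /run_sum.
  under [RHS]eq_bigr do rewrite exchange_big /=.
  rewrite [RHS]exchange_big /=; apply: eq_bigr => k _.
  under [RHS]eq_bigr do rewrite -expect_sum.
  rewrite -expect_sum; apply: eq_expect => h _.
  rewrite (bigD1 (last_obs y0 h)) //= [X in _ + X]big1 => [|y]; last first.
    rewrite eq_sym => /negPf neq; apply: big1 => u _.
    by rewrite neq mul0r !mulr0.
  rewrite addr0 mulr_sumr; apply: eq_bigr => u _.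
  by rewrite eqxx mul1r [f _ u * _]mulrC.
have occ0 y u : 0 <= occ y u.
  apply: sumr_ge0 => k _; apply: expect_ge0 => // h.
  by rewrite !mulr_ge0 // (phiP h).1.
have balance y' : `|\sum_y \sum_u occ y u * (p i u y y' - (y == y')%:R)| <= 1.
  pose g y := (y == y')%:R : R.
  have -> : \sum_y \sum_u occ y u * (p i u y y' - (y == y')%:R) =
      expect p y0 phi i n ((g \o last_obs y0) \o stopped S) - g y0.
    rewrite dynkin // [X in X + _ - _](_ : _ = g y0) // addrAC subrr add0r.
    rewrite -(occE (fun y u => p i u y y' - (y == y')%:R)).
    apply: eq_run_sum => h; rewrite step_obs //; apply: eq_bigr => u _.
    congr (_ * (_ - _)); rewrite (bigD1 y') //= /g eqxx mulr1 big1 ?addr0 //.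
    by move=> y /negPf ->; rewrite mulr0.
  have E0 : 0 <= expect p y0 phi i n ((g \o last_obs y0) \o stopped S).
    by apply: expect_ge0.
  have E1 : expect p y0 phi i n ((g \o last_obs y0) \o stopped S) <= 1.
    rewrite -[leRHS](expect_cst y0 p_pmf phiP i n); apply: le_expect => // h _ _.
    by rewrite /g /=; case: eqP.
  by rewrite ler_norml /g; case: eqP => _ /=; apply/andP; split; lra.
have [q qP [N N0 approx]] := occupation_measure y0 p_pmf p_gt0 e0 pe
  (fun _ => phiP [::]) occ0 balance.
have [j ji info_le] := dmax q qP.
have := data_processing phiP i s0 (sD j ji).
have -> : expect p y0 phi i n (llr i j \o stopped S) =
    \sum_y \sum_u occ y u * KL (p i u y) (p j u y).
  rewrite dynkin // llr_nil add0r -occE; apply: eq_run_sum => h.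
  exact: step_llr.
rewrite (occE (fun _ u => c u)).
have := approx (fun y u => KL (p i u y) (p j u y)) B1 (fun y u => KLB (j, y, u)).
have := approx (fun _ u => c u) B2 (fun _ u => cB u).
rewrite -/(info_rate p q i j) -/(cost_rate p c q i) !ler_norml.
move=> /andP[cost_le _] /andP[_ KL_le] sP.
have le1 : N * info_rate p q i j <= d * (N * cost_rate p c q i).
  by rewrite mulrCA ler_wpM2l.
have le2 : d * (N * cost_rate p c q i)
    <= d * (\sum_y \sum_u occ y u * c u + B2 / e).
  by rewrite ler_wpM2l //; lra.
rewrite mulrDr in le2; lra.
Qed.

End Converse.
(** * The exploration schedule *)

Section Exploration.
Variables (R : realType) (a : R).
Hypothesis a_gt1 : 1 < a.

Let a_gt0 : 0 < a. Proof. exact: lt_trans a_gt1. Qed.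

Lemma bernoulli n : 1 + n%:R * (a - 1) <= a ^+ n.
Proof.
elim: n => [|n IH]; first by rewrite mul0r addr0 expr0.
have : a * (1 + n%:R * (a - 1)) <= a * a ^+ n by rewrite ler_pM2l.
rewrite -exprS; apply: le_trans; rewrite -subr_ge0 -natr1.
have -> : a * (1 + n%:R * (a - 1)) - (1 + (n%:R + 1) * (a - 1))
  = n%:R * (a - 1) ^+ 2 by ring.
by rewrite mulr_ge0 ?sqr_ge0.
Qed.

Lemma expr_unbounded (x : R) : exists n, x < a ^+ n.
Proof.
exists (Num.truncn (`|x| / (a - 1))).+1; apply: lt_le_trans (bernoulli _).
have a1 : 0 < a - 1 by rewrite subr_gt0.
have : `|x| / (a - 1) < (Num.truncn (`|x| / (a - 1))).+1%:R by exact: truncnS_gt.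
rewrite ltr_pdivrMr // => lt1; have := ler_norm x; lra.
Qed.

Lemma ceil_expr_nat l : ((`|Num.ceil (a ^+ l)|%N)%:Z = Num.ceil (a ^+ l)).
Proof.
by rewrite gez0_abs // -(ler0z R) (le_trans _ (ceil_ge _)) // exprn_ge0 // ltW.
Qed.

Definition num_explorations n : nat := \sum_(k < n) exploration_time a k.+1.

Lemma num_explorationsS n :
  num_explorations n.+1 = (num_explorations n + exploration_time a n.+1)%N.
Proof. exact: big_ord_recr. Qed.

Lemma next_exploration e : (0 < e)%N -> exists e', [/\ (e < e')%N,
  exploration_time a e' & e'%:R < a * e%:R + 1].
Proof.
move=> e0; have [l le_l lmin] := find_ex_minn (expr_unbounded e%:R).
have l0 : (0 < l)%N.
  by case: l le_l {lmin} => //; rewrite expr0 ltNge ler1n e0.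
exists `|Num.ceil (a ^+ l)|%N; split.
- rewrite -(ltr_nat R); apply: (lt_le_trans le_l).
  by rewrite -[_%:R]/(_%:Z%:~R) ceil_expr_nat ceil_ge.
- by apply/asboolP; exists l; rewrite ceil_expr_nat.
- rewrite -[X in X < _]/(_%:Z%:~R) ceil_expr_nat.
  have lt1 : (Num.ceil (a ^+ l))%:~R < a ^+ l + 1.
    have := ceilB1_lt (a ^+ l); rewrite intrB; lra.
  apply: (lt_le_trans lt1); rewrite lerD2r -(prednK l0) exprS ler_pM2l // leNgt.
  by apply/negP => /lmin; rewrite -ltnS prednK // ltnn.
Qed.

Let s := (a - 1)^-1.

Let s_gt0 : 0 < s. Proof. by rewrite invr_gt0 subr_gt0. Qed.

(* [s] is chosen so that [e -> a * e + 1] is multiplication by [a] once [s] has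
   been added to both sides. *)
Let sE : 1 + s = a * s.
Proof. by rewrite /s; field; rewrite subr_eq0 gt_eqF. Qed.

(** If [e] is the last exploration up to time [n], the next one, which is
    later than [n], comes before [a * e + 1]; so the logarithm of [n] to base
    [a] grows by at most 1, in the long run, per exploration. *)
Lemma num_explorations_ge n :
  n%:R + s <= a ^+ num_explorations n * (1 + s).
Proof.
case: n => [|n]; first by rewrite /num_explorations big_ord0 mul1r lerD2r.
suff [e [e_gt0 e_last le_e]] : exists e, [/\ (0 < e)%N,
    forall k, (e < k <= n.+1)%N -> ~~ exploration_time a k &
    a * (e%:R + s) <= a ^+ num_explorations n.+1 * (1 + s)].
  apply: le_trans le_e.
  have [e' [ee' expl_e' lt_e']] := next_exploration e_gt0.
  have : (n.+1 < e')%N.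
    rewrite ltnNge; apply/negP => e'n.
    by have := e_last e'; rewrite ee' e'n expl_e' => /(_ isT).
  rewrite -(ltr_nat R) => lt1; rewrite mulrDr -sE; lra.
have expl1 : exploration_time a 1 by apply/asboolP; exists 0; rewrite expr0 ceil1.
elim: n => [|n [e [e_gt0 e_last le_e]]].
  exists 1; split => //; first by move=> k; rewrite ltnNge; case: (k <= 1)%N.
  by rewrite /num_explorations big_ord_recr big_ord0 /= expl1 expr1.
have [e' [ee' expl_e' lt_e']] := next_exploration e_gt0.
have ne' : (n.+1 < e')%N.
  rewrite ltnNge; apply/negP => e'n.
  by have := e_last e'; rewrite ee' e'n expl_e' => /(_ isT).
rewrite num_explorationsS; have [expl|expl] := boolP (exploration_time a n.+2).
  exists n.+2; split => //; first by move=> k; rewrite ltnNge; case: (k <= _)%N.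
  rewrite addn1 exprS -mulrA ler_pM2l //; apply: le_trans le_e.
  have : n.+2%:R <= e'%:R :> R by rewrite ler_nat.
  by rewrite mulrDr -sE; lra.
exists e; split => //; last by rewrite addn0.
move=> k /andP[ek]; rewrite leq_eqVlt => /orP[/eqP -> //|kn].
by apply: e_last; rewrite ek.
Qed.

Lemma num_explorations_le_exponent n L :
  n%:R < a ^+ L -> (num_explorations n <= L)%N.
Proof.
move=> nL; pose r := [seq k <- iota 1 n | exploration_time a k].
have -> : num_explorations n = size r.
  rewrite size_filter -sum1_count big_mkcond /= -[1%N]addn0 iotaDl big_map.
  have -> : iota 0 n = index_iota 0 n by rewrite /index_iota subn0.
  by rewrite big_mkord; apply: eq_bigr => k _; rewrite add1n; case: exploration_time.
have -> : L = size [seq `|Num.ceil (a ^+ l)|%N | l <- iota 0 L].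
  by rewrite size_map size_iota.
apply: uniq_leq_size; first by rewrite filter_uniq ?iota_uniq.
move=> k; rewrite mem_filter mem_iota => /andP[/asboolP[l kl] /andP[_ kn]].
apply/mapP; exists l; last by rewrite -kl.
rewrite mem_iota /= add0n -(ltr_eXn2l a_gt1); apply: le_lt_trans nL.
apply: (le_trans (ceil_ge _)); rewrite -kl ler_nat.
by rewrite add1n ltnS in kn.
Qed.

(** Explorations have density 0, since [a ^+ l] outgrows every linear function
    of [l]. *)
Lemma num_explorations_le (eta : R) : 0 < eta -> exists2 C : R, 0 <= C &
  forall n, (num_explorations n)%:R <= eta * n%:R + C.
Proof.
move=> eta0; have [l0 le_l0] := expr_unbounded (eta * (a - 1))^-1.
exists (l0%:R + 1); first by rewrite addr_ge0.
move=> n; pose m := (Num.truncn (eta * n%:R)).+1.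
have m_gt : eta * n%:R < m%:R by exact: truncnS_gt.
have m_le : m%:R <= eta * n%:R + 1.
  by rewrite -natr1 lerD2r truncn_le // mulr_ge0 // ltW.
suff : (num_explorations n <= l0 + m)%N.
  by rewrite -(ler_nat R) natrD; lra.
apply: num_explorations_le_exponent.
have a1 : 0 < a - 1 by rewrite subr_gt0.
apply: (@lt_le_trans _ _ ((eta * (a - 1))^-1 * (m%:R * (a - 1)))).
  have -> : (eta * (a - 1))^-1 * (m%:R * (a - 1)) = m%:R / eta.
    by field; rewrite !gt_eqF.
  by rewrite ltr_pdivlMr // mulrC.
rewrite exprD; apply: ler_pM.
- by rewrite invr_ge0 mulr_ge0 // ltW.
- by rewrite mulr_ge0 // ltW.
- exact: ltW.
- by apply: le_trans (bernoulli m); rewrite lerDr.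
Qed.

Lemma sum_inv_sqr n : \sum_(k < n) (k%:R + s) ^- 2 <= s ^- 2 + s^-1.
Proof.
case: n => [|n].
  by rewrite big_ord0 addr_ge0 // invr_ge0 ?sqr_ge0 // ltW.
suff le1 m : \sum_(k < m.+1) (k%:R + s) ^- 2 <= s ^- 2 + s^-1 - (m%:R + s)^-1.
  apply: le_trans (le1 _) _; rewrite lerBlDr lerDl invr_ge0.
  by rewrite addr_ge0 // ltW.
elim: m => [|m IH]; first by rewrite big_ord_recr big_ord0 /= !add0r addrK.
rewrite big_ord_recr /=.
have m1 : 0 < m%:R + s by rewrite ltr_wpDl.
have m2 : 0 < m.+1%:R + s by rewrite ltr_wpDl.
suff : (m.+1%:R + s) ^- 2 <= (m%:R + s)^-1 - (m.+1%:R + s)^-1 by lra.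
have -> : (m%:R + s)^-1 - (m.+1%:R + s)^-1
    = (m%:R + s)^-1 * (m.+1%:R + s)^-1.
  by move: m1 m2; rewrite -natr1 => m1 m2; field; rewrite !gt_eqF.
rewrite expr2 invfM ler_pM2r ?invr_gt0 // lef_pV2 ?posrE //.
by rewrite lerD2r ler_nat.
Qed.

End Exploration.

(** * Errors of the maximum likelihood estimator *)

Section Bhattacharyya.
Variables (R : realType) (Y U : finType) (M : nat).
Variables (p : 'I_M -> U -> Y -> Y -> R) (y0 : Y).
Hypothesis p_pmf : forall i u yt, is_pmf (p i u yt).
Hypothesis p_gt0 : forall i u yt y, 0 < p i u yt y.
Local Notation hst := (seq (Y * U)).

Definition root_lr j i (h : hst) : R :=
  Num.sqrt (lik p y0 j h / lik p y0 i h).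

Lemma root_lr_rcons j i h z : root_lr j i (rcons h z) =
  root_lr j i h * Num.sqrt (p j z.2 (last_obs y0 h) z.1 / p i z.2 (last_obs y0 h) z.1).
Proof.
rewrite /root_lr !lik_rcons -sqrtrM; last by rewrite divr_ge0 // ltW // lik_gt0.
by rewrite mulrACA invfM.
Qed.

Lemma root_lr_ge0 j i h : 0 <= root_lr j i h. Proof. exact: sqrtr_ge0. Qed.

Let w j i u yt y := Num.sqrt (p i u yt y * p j u yt y).

Let p_root j i u yt y :
  p i u yt y * Num.sqrt (p j u yt y / p i u yt y) = w j i u yt y.
Proof.
have := p_gt0 i u yt y; have := p_gt0 j u yt y.
rewrite /w; move: (p i u yt y) (p j u yt y) => b d d0 b0.
have {1}-> : b = Num.sqrt (b ^+ 2) by rewrite sqrtr_sqr ger0_norm // ltW.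
rewrite -sqrtrM ?sqr_ge0 //; congr Num.sqrt.
by field; rewrite gt_eqF.
Qed.

Lemma step_root_lr phi j i (f : Y -> R) h :
  step p y0 phi i (fun g => root_lr j i g * f (last_obs y0 g)) h =
  root_lr j i h * \sum_u phi h u * \sum_y w j i u (last_obs y0 h) y * f y.
Proof.
rewrite /step mulr_sumr; apply: eq_bigr => u _; rewrite mulrCA; congr (_ * _).
rewrite mulr_sumr; apply: eq_bigr => y _.
by rewrite last_obs_rcons root_lr_rcons /= -p_root; ring.
Qed.

Lemma step_root_lr1 phi j i h : step p y0 phi i (root_lr j i) h =
  root_lr j i h * \sum_u phi h u * \sum_y w j i u (last_obs y0 h) y.
Proof.
have := step_root_lr phi j i (fun=> 1) h.
rewrite (_ : (fun g => _) = root_lr j i); last by apply/funext => g; rewrite mulr1.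
by move=> ->; under eq_bigr do under eq_bigr do rewrite mulr1.
Qed.

(** The Bhattacharyya coefficient is 1 minus half the squared Hellinger
    distance. *)
Lemma affinityE j i u yt : \sum_y w j i u yt y =
  1 - 2^-1 * \sum_y (Num.sqrt (p i u yt y) - Num.sqrt (p j u yt y)) ^+ 2.
Proof.
have eq1 : 1 = 2^-1 * \sum_y (p i u yt y + p j u yt y) :> R.
  by rewrite big_split /= !(p_pmf _ _ _).2; field.
rewrite [X in X - _]eq1 -mulrBr -sumrB mulr_sumr; apply: eq_bigr => y _.
rewrite /w sqrtrM ?(ltW (p_gt0 _ _ _ _)) //.
rewrite -{2}[p i u yt y]sqr_sqrtr ?ltW // -{2}[p j u yt y]sqr_sqrtr ?ltW //.
by move: (Num.sqrt (p i _ _ _)) (Num.sqrt (p j _ _ _)) => b d; field.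
Qed.

Lemma affinity_le1 j i u yt : \sum_y w j i u yt y <= 1.
Proof.
rewrite affinityE lerBlDr lerDl mulr_ge0 // sumr_ge0 // => y _.
exact: sqr_ge0.
Qed.

Lemma affinity_lt1 j i u yt y : p i u yt y != p j u yt y ->
  \sum_y w j i u yt y < 1.
Proof.
move=> neq; rewrite affinityE ltrBlDr ltrDl mulr_gt0 //.
rewrite lt0r sumr_ge0 ?andbT => [|z _]; last exact: sqr_ge0.
rewrite psumr_neq0 => [|z _]; last exact: sqr_ge0.
apply/hasP; exists y; rewrite ?mem_index_enum //= exprn_even_gt0 //=.
apply: contra neq; rewrite subr_eq0 => /eqP sq.
by rewrite -[p i _ _ _]sqr_sqrtr ?ltW // sq sqr_sqrtr // ltW.
Qed.

Lemma expect_root_lr_decr phi j i n : is_policy phi ->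
  expect p y0 phi i n.+1 (root_lr j i) <= expect p y0 phi i n (root_lr j i).
Proof.
move=> phiP; rewrite expectS; apply: le_expect => // h _ _.
rewrite step_root_lr1 -[leRHS]mulr1 ler_wpM2l ?root_lr_ge0 //.
rewrite -(phiP h).2; apply: ler_sum => u _; rewrite -[leRHS]mulr1.
rewrite ler_wpM2l ?(phiP h).1 //.
exact: affinity_le1.
Qed.

(** A uniform control separates [i] from [j] only in those states where some
    control distinguishes them; as every transition is possible, such a state
    is reached in the step before the exploration with probability bounded
    below. *)
Lemma exploration_contraction j i :
  (exists u yt y, p i u yt y != p j u yt y) ->
  exists rho : R, [/\ 0 < rho, rho < 1 & forall phi n, is_policy phi ->
    (forall h u, size h = n.+1 -> phi h u = #|U|%:R^-1) ->
    expect p y0 phi i n.+2 (root_lr j i)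
      <= rho * expect p y0 phi i n (root_lr j i)].
Proof.
move=> [u1 [y1 [z1 neq]]].
have U0 : 0 < #|U|%:R :> R by rewrite ltr0n; apply/card_gt0P; exists u1.
have [x|e e0 w_ge] := @fin_lower_bound R (U * Y * Y)%type
    (fun x => w j i x.1.1 x.1.2 x.2).
  by rewrite sqrtr_gt0 mulr_gt0.
pose b y := #|U|%:R^-1 * \sum_u \sum_z w j i u y z.
have b_le1 y : b y <= 1.
  rewrite /b mulrC ler_pdivrMr // mul1r -sum1_card natr_sum.
  by apply: ler_sum => u _; exact: affinity_le1.
have b_lt1 : b y1 < 1.
  rewrite /b mulrC ltr_pdivrMr // mul1r -sum1_card natr_sum.
  rewrite (bigD1 u1) //= [ltRHS](bigD1 u1) //= ltr_leD ?(affinity_lt1 neq) //.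
  by apply: ler_sum => u _; exact: affinity_le1.
exists (Num.max (1 - e * (1 - b y1)) 2^-1); split.
- by rewrite lt_max invr_gt0 ltr0n orbT.
- rewrite gt_max invf_lt1 ?ltr1n // andbT gtrBl mulr_gt0 // subr_gt0.
  exact: b_lt1.
move=> phi n phiP phi_unif; rewrite expectS.
rewrite (_ : expect _ _ _ _ _ _ = expect p y0 phi i n.+1
    (fun g => root_lr j i g * b (last_obs y0 g))); last first.
  apply: eq_expect => h hn; rewrite step_root_lr1 /b; congr (_ * _).
  by rewrite mulr_sumr; apply: eq_bigr => u _; rewrite phi_unif.
rewrite expectS -expectZ; apply: le_expect => // h _ _.
rewrite step_root_lr [leRHS]mulrC ler_wpM2l ?root_lr_ge0 //.
rewrite le_max; apply/orP; left; set rho := 1 - _.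
rewrite -[rho]mul1r -(phiP h).2 mulr_suml; apply: ler_sum => u _.
rewrite ler_wpM2l ?(phiP h).1 //.
have -> : \sum_y w j i u (last_obs y0 h) y * b y = \sum_y w j i u (last_obs y0 h) y
    - \sum_y w j i u (last_obs y0 h) y * (1 - b y).
  by rewrite -sumrB; apply: eq_bigr => y _; ring.
rewrite lerB ?affinity_le1 // (bigD1 y1) //= -[leLHS]addr0 lerD //.
  rewrite ler_wpM2r ?subr_ge0 ?b_le1 //.
  exact: (w_ge (u, last_obs y0 h, y1)).
apply: sumr_ge0 => y _; rewrite mulr_ge0 ?subr_ge0 ?b_le1 //.
exact: sqrtr_ge0.
Qed.

End Bhattacharyya.

Section MLErrors.
Variables (R : realType) (Y U : finType) (M : nat).
Variables (p : 'I_M -> U -> Y -> Y -> R) (y0 : Y).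
Hypothesis p_pmf : forall i u yt, is_pmf (p i u yt).
Hypothesis p_gt0 : forall i u yt y, 0 < p i u yt y.
Local Notation hst := (seq (Y * U)).

Lemma policy_star_is_policy a (qs : 'I_M -> Y -> U -> R) ihat :
  (forall i, is_cond_pmf (qs i)) -> is_policy (policy_star y0 a qs ihat).
Proof.
move=> qsP h; rewrite /policy_star.
case: (exploration_time a _); last exact: qsP.
have U0 : (0 < #|U|)%N.
  rewrite lt0n; apply/negP => /eqP/card0_eq U0.
  have := (qsP (ihat [::]) y0).2.
  by rewrite big_pred0 // => /eqP; rewrite eq_sym oner_eq0.
split=> [u|]; first by rewrite invr_ge0.
by rewrite sumr_const -[LHS]mulr_natr mulVf // pnatr_eq0 -lt0n.
Qed.

(** A pair of consecutive times that ends with an exploration contains at most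
    two explorations and multiplies the expectation by at most
    [rho = a0 ^- 4], so each exploration counts for a factor [a0 ^- 2]. *)
Lemma expect_root_lr_le j i : (exists u yt y, p i u yt y != p j u yt y) ->
  exists2 a0 : R, 1 < a0 &
  forall a (qs : 'I_M -> Y -> U -> R) ihat, (forall i, is_cond_pmf (qs i)) ->
    forall n, expect p y0 (policy_star y0 a qs ihat) i n (root_lr p y0 j i)
      * a0 ^+ (2 * num_explorations a n) <= a0 ^+ 2.
Proof.
move=> /(exploration_contraction y0 p_pmf p_gt0)[rho [rho0 rho1 contr]].
pose a0 := expR (- ln rho / 4).
have a01 : 1 < a0.
  by rewrite expR_gt1 divr_gt0 // oppr_gt0 ln_lt0 // rho0.
have a0rho : a0 ^+ 4 * rho = 1.
  rewrite -expRM_natl [_ * (_ / _)]mulrC divfK // expRN lnK ?posrE //.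
  by rewrite mulVf // gt_eqF.
have a00 : 0 < a0 by exact: expR_gt0.
exists a0 => // a qs ihat qsP; set phi := policy_star _ _ _ _.
have phiP : is_policy phi by exact: policy_star_is_policy.
pose e n := expect p y0 phi i n (root_lr p y0 j i).
pose X := num_explorations a.
have e_ge0 n : 0 <= e n by apply: expect_ge0 => // h; exact: root_lr_ge0.
have e_decr n : e n.+1 <= e n by exact: expect_root_lr_decr.
have e0 : e 0 = 1 by rewrite /e expect0 /root_lr !lik_nil divr1 sqrtr1.
have a0_le k l : (k <= l)%N -> a0 ^+ k <= a0 ^+ l by rewrite ler_eXn2l.
have XS n : (X n.+1 <= (X n).+1)%N.
  by rewrite /X num_explorationsS -[leqRHS]addn1 leq_add2l leq_b1.
suff le1 n : e n * a0 ^+ (2 * X n) <= a0 ^+ 2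
    /\ e n.+1 * a0 ^+ (2 * X n.+1) <= a0 ^+ 2.
  by move=> n; have [] := le1 n.
elim: n => [|n [IH1 IH2]].
  have X0 : X 0 = 0%N by rewrite /X /num_explorations big_ord0.
  rewrite X0 e0 mul1r; split; first exact: a0_le.
  rewrite -[leRHS]mul1r; apply: ler_pM => //.
  - by rewrite exprn_ge0 // ltW.
  - by rewrite -e0.
  - have X1 : (X 1 <= 1)%N by have := XS 0; rewrite X0.
    by apply: (a0_le (2 * X 1)%N 2); move: X1; case: (X 1) => [|[]].
split=> //; have [expl|noexpl] := boolP (exploration_time a n.+2); last first.
  rewrite /X num_explorationsS (negPf noexpl) addn0; apply: le_trans IH2.
  by rewrite ler_wpM2r // exprn_ge0 // ltW.
have contr_n : e n.+2 <= rho * e n.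
  by apply: contr => // h u hn; rewrite /phi /policy_star hn expl.
have X2 : (2 * X n.+2 <= 2 * X n + 4)%N.
  by have := XS n; have := XS n.+1; lia.
apply: (@le_trans _ _ (rho * e n * a0 ^+ (2 * X n + 4))).
  by apply: ler_pM => //; [rewrite exprn_ge0 // ltW|exact: a0_le].
rewrite exprD (_ : _ * _ = e n * a0 ^+ (2 * X n) * (a0 ^+ 4 * rho)); last by ring.
by rewrite a0rho mulr1.
Qed.

(** At an error the likelihood ratio of some alternative is at least 1; its
    root has summable expectations, as the number of explorations is at least
    logarithmic. *)
Lemma ML_errors_summable :
  exists2 a0 : R, 1 < a0 & forall a, 1 < a < a0 ->
  forall qs : 'I_M -> Y -> U -> R, (forall i, is_cond_pmf (qs i)) ->
  forall ihat, is_ML p y0 a qs ihat ->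
  forall i, (forall j, j != i -> exists u yt y, p i u yt y != p j u yt y) ->
  exists2 C : R, 0 <= C & forall n,
    \sum_(k < n) expect p y0 (policy_star y0 a qs ihat) i k
      (fun h => (ihat h != i)%:R) <= C.
Proof.
pose good j i := exists u yt y, p i u yt y != p j u yt y.
have [a_ a_gt1 a_P] : exists2 a_ : 'I_M * 'I_M -> R, (forall x, 1 < a_ x) &
  forall x, good x.1 x.2 ->
    forall a (qs : 'I_M -> Y -> U -> R) ihat, (forall i, is_cond_pmf (qs i)) ->
    forall n, expect p y0 (policy_star y0 a qs ihat) x.2 n (root_lr p y0 x.1 x.2)
      * a_ x ^+ (2 * num_explorations a n) <= a_ x ^+ 2.
  have /choice[a_ a_P] : forall x : 'I_M * 'I_M, exists b : R, 1 < b /\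
    (good x.1 x.2 ->
      forall a (qs : 'I_M -> Y -> U -> R) ihat, (forall i, is_cond_pmf (qs i)) ->
      forall n, expect p y0 (policy_star y0 a qs ihat) x.2 n (root_lr p y0 x.1 x.2)
        * b ^+ (2 * num_explorations a n) <= b ^+ 2).
    move=> x; have [/expect_root_lr_le[b b1 bP]|ngood] := pselect (good x.1 x.2).
      by exists b.
    by exists 2; split; first by rewrite ltr1n.
  by exists a_ => x; have [] := a_P x.
exists (\big[Num.min/2]_x a_ x).
  by apply: lt_bigmin => //; rewrite ltr1n.
move=> a /andP[a1 a_lt] qs qsP ihat ihatP i dist.
set phi := policy_star _ _ _ _.
have phiP : is_policy phi by exact: policy_star_is_policy.
pose s := (a - 1)^-1.
have s0 : 0 < s by rewrite invr_gt0 subr_gt0.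
have a0 : 0 < a by exact: lt_trans a1.
pose B j := (a_ (j, i) * (1 + s)) ^+ 2.
exists (\sum_(j | j != i) B j * (s ^- 2 + s^-1)).
  apply: sumr_ge0 => j _; rewrite mulr_ge0 ?sqr_ge0 // addr_ge0 // invr_ge0.
    exact: sqr_ge0.
  exact: ltW.
move=> n.
have root_le j k : j != i ->
    expect p y0 phi i k (root_lr p y0 j i) <= B j * (k%:R + s) ^- 2.
  move=> ji; have aj1 := a_gt1 (j, i).
  have ks0 : 0 < k%:R + s by rewrite ltr_wpDl.
  have := a_P (j, i) (dist j ji) a qs ihat qsP k; rewrite -/phi /=.
  set E := expect _ _ _ _ _ _ => le1.
  have E0 : 0 <= E by apply: expect_ge0 => // h; exact: root_lr_ge0.
  rewrite ler_pdivlMr ?exprn_gt0 // /B exprMn.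
  apply: (@le_trans _ _ (E * (a_ (j, i) ^+ num_explorations a k * (1 + s)) ^+ 2)).
    rewrite ler_wpM2l // ler_sqr ?nnegrE ?(ltW ks0) //; last first.
      by rewrite mulr_ge0 ?addr_ge0 ?exprn_ge0 // ltW // (lt_trans _ aj1).
    apply: le_trans (num_explorations_ge a1 k) _.
    rewrite ler_wpM2r ?addr_ge0 ?(ltW s0) // lerXn2r ?nnegrE ?(ltW a0) //.
      by rewrite ltW // (lt_trans _ aj1).
    by apply: ltW; apply: (lt_le_trans a_lt); exact: bigmin_le.
  by rewrite exprMn mulrA -exprM mulnC ler_wpM2r ?sqr_ge0.
have err_le k : expect p y0 phi i k (fun h => (ihat h != i)%:R) <=
    \sum_(j | j != i) expect p y0 phi i k (root_lr p y0 j i).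
  rewrite -expect_sum; apply: le_expect => // h _ h0.
  case: eqVneq => [_|ne_i]; first by apply: sumr_ge0 => j _; exact: root_lr_ge0.
  rewrite (bigD1 (ihat h)) //= -[leLHS]addr0 lerD //; last first.
    by apply: sumr_ge0 => j _; exact: root_lr_ge0.
  rewrite /root_lr -[leLHS]sqrtr1 ler_wsqrtr // ler_pdivlMr ?lik_gt0 // mul1r.
  by rewrite -(ler_pM2r h0); exact: ihatP.
apply: (@le_trans _ _ (\sum_(k < n) \sum_(j | j != i)
    expect p y0 phi i k (root_lr p y0 j i))); first by apply: ler_sum.
rewrite exchange_big /=; apply: ler_sum => j ji.
apply: (@le_trans _ _ (\sum_(k < n) B j * (k%:R + s) ^- 2)).
  by apply: ler_sum => k _; exact: root_le.
by rewrite -mulr_sumr ler_wpM2l ?sqr_ge0 // sum_inv_sqr.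
Qed.

End MLErrors.

(** * Achievability *)

Lemma expR_le_quadratic (R : realType) (x : R) :
  x <= 2^-1 -> expR x <= 1 + x + 2 * x ^+ 2.
Proof.
move=> x2; have x1 : 0 < 1 - x by lra.
have le1 : expR x <= (1 - x)^-1.
  rewrite -[expR x]invrK -expRN lef_pV2 ?posrE ?expR_gt0 //.
  exact: expR_ge1Dx.
apply: (le_trans le1); rewrite -[leLHS]mul1r ler_pdivrMr //.
have -> : (1 + x + 2 * x ^+ 2) * (1 - x) = 1 + x ^+ 2 * (1 - 2 * x) by ring.
by rewrite lerDl mulr_ge0 ?sqr_ge0 //; lra.
Qed.

(** Summation by parts: weights that decrease preserve the bound on the
    partial sums of [x]. *)
Lemma abel_le (R : realType) (w x : nat -> R) (eta C : R) :
  0 <= C -> (forall n, 0 <= w n) -> (forall n, w n.+1 <= w n) ->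
  (forall n, \sum_(k < n) x k <= eta * n%:R + C) ->
  forall n, \sum_(k < n) w k * x k <= eta * (\sum_(k < n) w k) + C * w 0%N.
Proof.
move=> C0 w0 w_decr xC n; pose A n := \sum_(k < n) (x k - eta).
have A_le m : A m <= C.
  by rewrite /A sumrB sumr_const card_ord -[eta *+ m]mulr_natr lerBlDl.
suff : \sum_(k < n) w k * (x k - eta) <= C * (w 0%N - w n) + A n * w n.
  have -> : \sum_(k < n) w k * (x k - eta)
      = \sum_(k < n) w k * x k - eta * \sum_(k < n) w k.
    by rewrite mulr_sumr -sumrB; apply: eq_bigr => k _; ring.
  have : A n * w n <= C * w n by rewrite ler_wpM2r.
  by rewrite mulrBr; lra.
elim: n => [|n IH]; first by rewrite big_ord0 subrr mulr0 /A big_ord0 mul0r addr0.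
rewrite big_ord_recr /=.
have : A n.+1 * (w n - w n.+1) <= C * (w n - w n.+1).
  by rewrite ler_wpM2r ?subr_ge0.
have -> : A n.+1 = A n + (x n - eta) by rewrite /A big_ord_recr.
move: IH; set s := \sum_(k < n) _; move: (A n) (x n) (w n) (w n.+1) (w 0%N).
by move=> a y v v' v0; lra.
Qed.

Section Achievability.
Variables (R : realType) (Y U : finType) (M : nat).
Variables (p : 'I_M -> U -> Y -> Y -> R) (y0 : Y) (c : U -> R).
Hypothesis p_pmf : forall i u yt, is_pmf (p i u yt).
Hypothesis p_gt0 : forall i u yt y, 0 < p i u yt y.
Hypothesis c_gt0 : forall u, 0 < c u.
Local Notation hst := (seq (Y * U)).

Variables (a : R) (qs : 'I_M -> Y -> U -> R) (ihat : hst -> 'I_M).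
Hypothesis a_gt1 : 1 < a.
Hypothesis qsP : forall i, is_cond_pmf (qs i).
Local Notation phi := (policy_star y0 a qs ihat).

Let phiP : is_policy phi. Proof. exact: policy_star_is_policy. Qed.

Variable i : 'I_M.

Definition bad (h : hst) : bool :=
  exploration_time a (size h).+1 || (ihat h != i).

Lemma policy_star_good h u : ~~ bad h -> phi h u = qs i (last_obs y0 h) u.
Proof.
by rewrite /bad negb_or /policy_star => /andP[/negPf -> /negPn /eqP ->].
Qed.

Let mixedE x (f : Y -> R) :
  \sum_y mixed_kernel p i (qs i) x y * f y =
  \sum_u qs i x u * \sum_y p i u x y * f y.
Proof.
under eq_bigr do rewrite /mixed_kernel mulr_suml.
rewrite exchange_big; apply: eq_bigr => u _ /=.
by rewrite mulr_sumr; apply: eq_bigr => y _; rewrite mulrA.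
Qed.

Let poisson (f : Y -> R) : exists g : Y -> R, forall x,
  f x + \sum_u qs i x u * (\sum_y p i u x y * g y - g x)
    = \sum_y stat_dist p i (qs i) y * f y.
Proof.
have [e e0 pe] := kernel_lower_bound p_gt0.
have [g gP] := poisson_equation e0 (mixed_kernel_ge i (qsP i) pe)
  (mixed_kernel_sum p_pmf i (qsP i)) y0 f (stat_distP y0 p_pmf p_gt0 i (qsP i)).
exists g => x; rewrite -(gP x) mixedE -addrA; congr (_ + _).
under eq_bigr do rewrite mulrBr.
by rewrite sumrB -mulr_suml (qsP i x).2 mul1r.
Qed.

(** Explorations have density 0, and the expected number of estimation errors
    is bounded by [CML]. *)
Lemma run_sum_bad (CML : R) : 0 <= CML ->
  (forall n, \sum_(k < n) expect p y0 phi i k (fun h => (ihat h != i)%:R) <= CML) ->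
  forall eta, 0 < eta -> exists2 C : R, 0 <= C & forall S n,
    run_sum p y0 phi i S n (fun h => (bad h)%:R)
      <= eta * run_sum p y0 phi i S n (fun=> 1) + C.
Proof.
move=> CML0 MLC eta eta0.
have [C C0 XC] := num_explorations_le a_gt1 eta0.
exists (C + CML); first exact: addr_ge0.
move=> S n; pose w k := expect p y0 phi i k (fun h => (~~ S (stopped S h))%:R).
have w0 k : 0 <= w k by apply: expect_ge0.
have w_decr k : w k.+1 <= w k by exact: expect_running_decr.
have w_le1 : w 0%N <= 1 by rewrite /w expect0 lern1 leq_b1.
have -> : run_sum p y0 phi i S n (fun=> 1) = \sum_(k < n) w k.
  by apply: eq_bigr => k _; apply: eq_expect => h _; rewrite mulr1.
apply: (@le_trans _ _ (\sum_(k < n) w k * (exploration_time a k.+1)%:R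
    + \sum_(k < n) expect p y0 phi i k (fun h => (ihat h != i)%:R))).
  rewrite -big_split; apply: ler_sum => k _ /=.
  rewrite mulrC -expectZ -expectD; apply: le_expect => // h hk _.
  rewrite /bad hk; case: (S _); case: exploration_time; case: (_ != _) => /=; lra.
rewrite addrA lerD //.
apply: le_trans (abel_le (x := fun k => (exploration_time a k.+1)%:R)
  C0 w0 w_decr _ n) _.
  by move=> m; rewrite -natr_sum; exact: XC.
by rewrite lerD2l -[leRHS]mulr1 ler_wpM2l.
Qed.

(** The soft minimum of the log-likelihood ratios against all alternatives,
    each corrected by the solution of its Poisson equation, drifts upwards at
    rate [I] outside the bad times, and stays below the threshold [b], up to
    a constant, until the test stops. *)
Lemma expected_time_le (I theta : R) : (1 < M)%N -> 0 < I -> 0 < theta ->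
  (forall j, j != i -> I <= info_rate p (qs i) i j) ->
  exists A C : R, [/\ 0 <= A, 0 <= C & forall (S : pred hst) (b : R) n, 0 <= b ->
    (forall h, 0 < pol_weight phi h -> (0 < size h)%N ->
       (forall j, j != i -> b < llr p y0 i j h) -> S h) ->
    (I - theta) * run_sum p y0 phi i S n (fun=> 1)
      <= b + C + A * run_sum p y0 phi i S n (fun h => (bad h)%:R)].
Proof.
move=> M1 I0 theta0 I_le.
pose f j y := \sum_u qs i y u * KL (p i u y) (p j u y).
have /choice[g gP] := fun j => poisson (f j).
have fE j : \sum_y stat_dist p i (qs i) y * f j y = info_rate p (qs i) i j.
  apply: eq_bigr => y _; rewrite mulr_sumr; apply: eq_bigr => u _.
  by rewrite mulrA.
have [B1 B1_ge0 lnB] := @fin_bound R ('I_M * U * Y * Y)%type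
  (fun x => ln (p i x.1.1.2 x.1.2 x.2 / p x.1.1.1 x.1.1.2 x.1.2 x.2)).
have [B2 B2_ge0 gB] := @fin_bound R ('I_M * Y)%type (fun x => g x.1 x.2).
pose B := B1 + 2 * B2 + 1.
have B_gt0 : 0 < B by rewrite /B; lra.
(* [eta] is small enough for the quadratic bound on [expR] to apply to
   increments of size [eta * B], and to make its second-order term at most
   [eta * theta]. *)
pose eta := Num.min (2 * B)^-1 (theta / (2 * B ^+ 2)).
have eta0 : 0 < eta.
  by rewrite lt_min invr_gt0 !mulr_gt0 // invr_gt0 mulr_gt0 ?exprn_gt0.
have etaB : eta * B <= 2^-1.
  apply: (@le_trans _ _ ((2 * B)^-1 * B)).
    by rewrite ler_wpM2r ?(ltW B_gt0) // ge_min lexx.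
  by rewrite invfM -mulrA mulVf ?mulr1 // gt_eqF.
have etaB2 : 2 * eta * B ^+ 2 <= theta.
  apply: (@le_trans _ _ (2 * (theta / (2 * B ^+ 2)) * B ^+ 2)).
    by rewrite ler_wpM2r ?sqr_ge0 // ler_wpM2l // ge_min lexx orbT.
  by rewrite le_eqVlt; apply/orP; left; apply/eqP; field; rewrite gt_eqF.
pose V j h := llr p y0 i j h + g j (last_obs y0 h).
pose D j h := step p y0 phi i (V j) h - V j h.
have V_incr j h z : `|V j (rcons h z) - V j h| <= B.
  rewrite /V last_obs_rcons llr_rcons //.
  have := lnB (j, z.2, last_obs y0 h, z.1); have := gB (j, last_obs y0 h).
  have := gB (j, z.1); rewrite /= /B !ler_norml.
  move: (ln _) (g j z.1) (g j (last_obs y0 h)) (llr _ _ _ _ h) => l g1 g2 l0.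
  by move=> /andP[? ?] /andP[? ?] /andP[? ?]; apply/andP; split; lra.
have D_good j h : ~~ bad h -> D j h = info_rate p (qs i) i j.
  move=> good; rewrite /D /V stepD opprD addrACA step_llr //.
  rewrite (step_obs y0 p_pmf phiP i (g j)) -fE -(gP j (last_obs y0 h)).
  by congr (_ + _); apply: eq_bigr => u _; rewrite policy_star_good.
have D_ge j h : - B <= D j h.
  rewrite /D -[X in _ - X](step_cst y0 p_pmf phiP i _ h).
  rewrite -[leLHS](step_cst y0 p_pmf phiP i _ h) lerBrDr -stepD.
  apply: le_step => // y u _.
  by have := V_incr j h (y, u); rewrite ler_norml => /andP[+ _]; rewrite lerBrDr.
have D_lower j h : j != i -> I - (I + B) * (bad h)%:R <= D j h.
  move=> ji; case: (boolP (bad h)) => hb.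
    by have := D_ge j h; rewrite mulr1; lra.
  by rewrite D_good // mulr0 subr0 I_le.
have [j0 j0i] : exists j0, j0 != i.
  by have [j [ji _ _]] := reward_attained y0 p_pmf p_gt0 c_gt0 i M1 (qsP i); exists j.
pose W h := \sum_(j | j != i) expR (- (eta * V j h)).
have W_ge j h : j != i -> expR (- (eta * V j h)) <= W h.
  by move=> ji; rewrite /W (bigD1 j) //= lerDl sumr_ge0 // => k _; exact: expR_ge0.
have W0 h : 0 < W h by apply: lt_le_trans (W_ge _ h j0i); exact: expR_gt0.
pose F h := - (ln (W h) / eta).
pose drift h := I - (I + B) * (bad h)%:R - theta.
(* [W] is a sum of exponentials, whose one-step expectations are bounded
   separately by the quadratic bound. *)
have W_drift h : step p y0 phi i W h <= W h * (1 - eta * drift h).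
  have -> : step p y0 phi i W h =
      \sum_(j | j != i) step p y0 phi i (fun g => expR (- (eta * V j g))) h.
    rewrite /step exchange_big /=; apply: eq_bigr => u _.
    rewrite -mulr_sumr; congr (_ * _); rewrite exchange_big /=.
    by apply: eq_bigr => y _; rewrite mulr_sumr.
  rewrite mulr_suml; apply: ler_sum => j ji.
  pose q := 1 + eta * V j h + 2 * (eta * B) ^+ 2.
  apply: (@le_trans _ _ (step p y0 phi i
      (fun g => expR (- (eta * V j h)) * (q + - eta * V j g)) h)).
    apply: le_step => // y u _.
    have := V_incr j h (y, u); set v' := V j (rcons _ _); set v := V j h => vB.
    have -> : - (eta * v') = - (eta * v) + eta * (v - v') by ring.
    rewrite expRD ler_pM2l ?expR_gt0 //.
    have : eta * (v - v') <= 2^-1.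
      apply: le_trans etaB; rewrite ler_pM2l // -opprB.
      by move: vB; rewrite ler_norml => /andP[+ _]; rewrite lerNl.
    move=> /expR_le_quadratic /le_trans; apply.
    have : (eta * (v - v')) ^+ 2 <= (eta * B) ^+ 2.
      rewrite -[leLHS]real_normK ?num_real // normrM distrC (gtr0_norm eta0).
      by rewrite lerXn2r ?nnegrE ?mulr_ge0 ?(ltW eta0) ?(ltW B_gt0) // ler_pM2l.
    by rewrite /q -/v mulrBr mulNr; move: (_ ^+ 2) (_ ^+ 2) => x x'; lra.
  rewrite stepZ stepD step_cst // stepZ ler_pM2l ?expR_gt0 //.
  have : eta * (I - (I + B) * (bad h)%:R) <= eta * D j h by rewrite ler_pM2l // D_lower.
  have : eta * (2 * eta * B ^+ 2) <= eta * theta by rewrite ler_pM2l.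
  rewrite /q /D /drift exprMn expr2.
  move: (step _ _ _ _ _ _) (V j h) ((I + B) * _) => s v k; lra.
(* The concavity of the logarithm makes the bound on [W] one on [F]. *)
have F_drift h : drift h <= step p y0 phi i F h - F h.
  rewrite lerBrDr.
  have FW h' : F h + eta^-1 + - (eta * W h)^-1 * W h' <= F h'.
    rewrite /F; have := ln_le_sub1 (divr_gt0 (W0 h') (W0 h)).
    rewrite ln_div ?posrE // => le1.
    have : eta^-1 * (ln (W h') - ln (W h)) <= eta^-1 * (W h' / W h - 1).
      by rewrite ler_pM2l ?invr_gt0.
    by rewrite invfM; lra.
  apply: (@le_trans _ _ (step p y0 phi i
      (fun h' => F h + eta^-1 + - (eta * W h)^-1 * W h') h)); last first.
    by apply: le_step => // y u _; exact: FW.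
  rewrite stepD step_cst // stepZ.
  have : (eta * W h)^-1 * step p y0 phi i W h
      <= (eta * W h)^-1 * (W h * (1 - eta * drift h)).
    by rewrite ler_pM2l ?invr_gt0 ?mulr_gt0 // W_drift.
  have -> : (eta * W h)^-1 * (W h * (1 - eta * drift h)) = eta^-1 - drift h.
    by field; rewrite !gt_eqF.
  by lra.
have F_le j h : j != i -> F h <= V j h.
  move=> ji; rewrite /F lerNl ler_pdivlMr // mulNr mulrC -ler_expR.
  by rewrite lnK ?posrE // W_ge.
exists (I + B), (B + `|F [::]|); split.
- exact: addr_ge0 (ltW I0) (ltW B_gt0).
- exact: addr_ge0 (ltW B_gt0) (normr_ge0 _).
move=> S b n b0 bS.
(* One step before stopping, some log-likelihood ratio is still at most [b]. *)
have F_stop : expect p y0 phi i n (F \o stopped S) <= b + B.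
  rewrite -[leRHS](expect_cst y0 p_pmf phiP i n); apply: le_expect => // h _ h0 /=.
  have V_le j h' : V j h' <= llr p y0 i j h' + B2.
    by rewrite lerD2l; have := gB (j, last_obs y0 h'); rewrite ler_norml => /andP[].
  have := pol_weight_gt0_stopped phiP S h0.
  have [->|[h' [z [-> Sh']]] hz] := stopped_running S h.
    move=> _; apply: le_trans (F_le j0 _ j0i) _.
    by have := V_le j0 [::]; rewrite llr_nil /B; lra.
  have [j ji llr_le] : exists2 j, j != i & llr p y0 i j h' <= b.
    have [h'0|h'0] := posnP (size h').
      by exists j0 => //; rewrite (size0nil h'0) llr_nil.
    apply/not_exists2P => all_gt; move/negP: Sh'; apply; apply: bS => //.
      exact: pol_weight_gt0_rcons hz.
    by move=> j ji; rewrite ltNge; apply/negP => le_b; case: (all_gt j).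
  apply: le_trans (F_le j _ ji) _; apply: le_trans (V_le _ _) _.
  rewrite llr_rcons //; have := lnB (j, z.2, last_obs y0 h', z.1).
  by rewrite ler_norml => /andP[_ /=]; rewrite /B; lra.
rewrite dynkin // in F_stop.
have : run_sum p y0 phi i S n drift <=
    run_sum p y0 phi i S n (fun h => step p y0 phi i F h - F h).
  by apply: le_run_sum => // h _ _.
have -> : run_sum p y0 phi i S n drift =
    (I - theta) * run_sum p y0 phi i S n (fun=> 1)
      + - (I + B) * run_sum p y0 phi i S n (fun h => (bad h)%:R).
  by rewrite -!run_sumZ -run_sumD; apply: eq_run_sum => h; rewrite /drift; ring.
have := ler_norm (- F [::]); rewrite normrN; lra.
Qed.

(** Outside the bad times the conditional expectation of the next cost differs
    from [cost_rate] by a telescoping term, by the Poisson equation. *)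
Lemma expected_cost_le : exists A C : R, [/\ 0 <= A, 0 <= C & forall S n,
  run_sum p y0 phi i S n (fun h => \sum_u phi h u * c u) <=
  cost_rate p c (qs i) i * run_sum p y0 phi i S n (fun=> 1) + C
    + A * run_sum p y0 phi i S n (fun h => (bad h)%:R)].
Proof.
pose f y := \sum_u qs i y u * c u; have [g gP] := poisson f.
have fE : \sum_y stat_dist p i (qs i) y * f y = cost_rate p c (qs i) i.
  apply: eq_bigr => y _; rewrite mulr_sumr; apply: eq_bigr => u _.
  by rewrite mulrA.
have rate0 : 0 < cost_rate p c (qs i) i by exact: cost_rate_gt0.
have [B1 B1_ge0 cB] := fin_bound c; have [B2 B2_ge0 gB] := fin_bound g.
exists (B1 + 2 * B2), (2 * B2); split; rewrite ?addr_ge0 ?mulr_ge0 //.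
move=> S n; pose G h := step p y0 phi i (g \o last_obs y0) h - g (last_obs y0 h).
have cost_le h : \sum_u phi h u * c u <=
    cost_rate p c (qs i) i * 1 + (- 1 * G h + (B1 + 2 * B2) * (bad h)%:R).
  have [hb|hb] := boolP (bad h).
    have : \sum_u phi h u * c u <= B1.
      rewrite -[leRHS]mul1r -(phiP h).2 mulr_suml; apply: ler_sum => u _.
      by rewrite ler_wpM2l ?(phiP h).1 // (le_trans (ler_norm _)).
    have : G h <= 2 * B2.
      rewrite /G lerBlDr; apply: (@le_trans _ _ B2).
        rewrite -[leRHS](step_cst y0 p_pmf phiP i _ h); apply: le_step => // y u _.
        exact: le_trans (ler_norm _) (gB _).
      by have := gB (last_obs y0 h); rewrite ler_norml => /andP[+ _]; lra.
    by rewrite !mulr1; lra.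
  rewrite /G step_obs // -fE -(gP (last_obs y0 h)).
  under eq_bigr do rewrite policy_star_good //.
  under [X in - 1 * X]eq_bigr do rewrite policy_star_good //.
  by rewrite -/(f (last_obs y0 h)) mulr0; lra.
have : run_sum p y0 phi i S n (fun h => \sum_u phi h u * c u) <=
    run_sum p y0 phi i S n (fun h => cost_rate p c (qs i) i * 1
      + (- 1 * G h + (B1 + 2 * B2) * (bad h)%:R)).
  by apply: le_run_sum => // h _ _; exact: cost_le.
rewrite !run_sumD !run_sumZ.
have := dynkin y0 p_pmf phiP S i n (g \o last_obs y0); rewrite -/G => dyn.
have : - B2 <= expect p y0 phi i n ((g \o last_obs y0) \o stopped S).
  rewrite -[leLHS](expect_cst y0 p_pmf phiP i n); apply: le_expect => // h _ _ /=.
  by have := gB (last_obs y0 (stopped S h)); rewrite ler_norml => /andP[].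
have : g y0 <= B2 by exact: le_trans (ler_norm _) (gB _).
by move: dyn; rewrite -/(run_sum _ _ _ _ _ _ G) [(_ \o _) [::]]/=; lra.
Qed.

(** The expected number [t] of steps satisfies [(1 - theta) I t <= b] and costs
    [d q <= (1 + theta) I t], up to constants, where [I = d * cost_rate]. *)
Lemma achievability_finite (CML : R) : (1 < M)%N ->
  attains_dstar p c i (qs i) -> (0 < dstar p c i)%E -> 0 <= CML ->
  (forall n, \sum_(k < n) expect p y0 phi i k (fun h => (ihat h != i)%:R) <= CML) ->
  forall delta, 0 < delta ->
  exists2 C : R, 0 <= C & forall (S : pred hst) (b : R) n, 0 <= b ->
    (forall h, 0 < pol_weight phi h -> (0 < size h)%N ->
       (forall j, j != i -> b < llr p y0 i j h) -> S h) ->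
    fine (dstar p c i) * run_sum p y0 phi i S n (fun h => \sum_u phi h u * c u)
      <= (1 + delta) * b + C.
Proof.
move=> M1 qs_opt d_gt0 CML0 MLC delta delta0.
have [d [d0 dE I_le _]] := dstar_value y0 p_pmf p_gt0 c_gt0 M1 qs_opt.
rewrite dE /= in d_gt0 *; rewrite lte_fin in d_gt0.
pose I := d * cost_rate p c (qs i) i.
have I0 : 0 < I by rewrite mulr_gt0 ?cost_rate_gt0.
(* [theta] solves (1 + theta) / (1 - theta) = 1 + delta *)
pose theta : R := delta / (2 + delta).
have theta0 : 0 < theta by rewrite divr_gt0 // addr_gt0.
have thetaE : 1 + theta = (1 + delta) * (1 - theta).
  by rewrite /theta; field; rewrite gt_eqF // addr_gt0.
have theta1 : 0 < 1 - theta.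
  have : 0 < (1 + delta) * (1 - theta) by rewrite -thetaE addr_gt0.
  by rewrite pmulr_rgt0 // addr_gt0.
have I2 : 0 < theta * I / 2 by rewrite divr_gt0 // mulr_gt0.
have [A1 [C1 [A1_ge0 C1_ge0 time_le]]] := expected_time_le M1 I0 I2 I_le.
have [A2 [C2 [A2_ge0 C2_ge0 cost_le]]] := expected_cost_le.
pose eta := (theta * I / 2) / (A1 + d * A2 + 1).
have A0 : 0 < A1 + d * A2 + 1 by rewrite ltr_wpDl // addr_ge0 // mulr_ge0.
have eta0 : 0 < eta by rewrite divr_gt0.
have etaE : (A1 + d * A2) * eta <= theta * I / 2.
  rewrite /eta mulrCA ler_piMr ?(ltW I2) // ler_pdivrMr // mul1r lerDl.
  exact: ler01.
have [C3 C3_ge0 bad_le] := run_sum_bad CML0 MLC eta0.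
exists ((1 + delta) * (C1 + A1 * C3) + d * (C2 + A2 * C3)).
  by rewrite addr_ge0 // mulr_ge0 ?addr_ge0 ?mulr_ge0 // ltW.
clearbody eta theta; move=> S b n b0 bS.
have := time_le S b n b0 bS; have := cost_le S n; have := bad_le S n.
set t := run_sum _ _ _ _ _ _ (fun=> 1); set k := run_sum _ _ _ _ _ _ _.
set q := run_sum _ _ _ _ _ _ _ => k_le q_le t_le.
have t0 : 0 <= t.
  by apply: sumr_ge0 => m _; apply: expect_ge0 => // h; rewrite mulr_ge0.
have A1k : A1 * k <= A1 * (eta * t + C3) by rewrite ler_wpM2l.
have A2k : d * (A2 * k) <= d * (A2 * (eta * t + C3)) by rewrite !ler_wpM2l.
have dq : d * q <= d * (cost_rate p c (qs i) i * t + C2 + A2 * k).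
  by rewrite ler_wpM2l.
have At : (A1 + d * A2) * eta * t <= theta * I / 2 * t by rewrite ler_wpM2r.
have A1t : 0 <= A1 * (eta * t) by rewrite !mulr_ge0 // ltW.
have A2t : 0 <= d * (A2 * (eta * t)) by rewrite !mulr_ge0 // ltW.
have tI : 0 <= theta * I * t.
  by rewrite mulr_ge0 // (mulr_ge0 (ltW theta0) (ltW I0)).
have It : (1 - theta) * I * t <= b + C1 + A1 * C3 by lra.
have qI : d * q <= (1 + theta) * I * t + d * (C2 + A2 * C3).
  by rewrite /I; rewrite /I in At tI; lra.
have : (1 + delta) * ((1 - theta) * I * t) <= (1 + delta) * (b + C1 + A1 * C3).
  by rewrite ler_pM2l // addr_gt0.
have -> : (1 + delta) * ((1 - theta) * I * t) = (1 + theta) * I * t.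
  by rewrite thetaE !mulrA.
by lra.
Qed.

End Achievability.

(** * From sequential tests to finite histories *)

Local Notation proc_of t := (@proc _ _ _ _ _ _ t).
Local Notation stop_of t := (@stop _ _ _ _ _ _ t).
Local Notation accepts_of t := (@accepts _ _ _ _ _ _ t).
Local Notation errs_of t := (@errs _ _ _ _ _ _ t).

Lemma first_timeP (Q : pred nat) (t : option nat) :
  (forall n, time_le t n -> exists2 m, (m <= n)%N & Q m) ->
  (forall n, Q n -> time_le t n) ->
  t = first_time Q.
Proof.
move=> tQ Qt; rewrite /first_time; case: pselect => [exQ|nQ].
  case: ex_minnP => m Qm mmin; case: t tQ Qt => [k|] tQ Qt; last by have := Qt m Qm.
  have [l lk Ql] := tQ k (leqnn k); congr Some; apply/eqP.
  by have /= km := Qt m Qm; rewrite eqn_leq km (leq_trans (mmin l Ql)).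
case: t tQ Qt => [k|] // tQ _; have [l _ Ql] := tQ k (leqnn k).
by case: nQ; exists l.
Qed.

Section Bridge.
Variables (R : realType) (Y U : finType) (M : nat).
Variables (p : 'I_M -> U -> Y -> Y -> R) (y0 : Y) (c : U -> R).
Hypothesis p_pmf : forall i u yt, is_pmf (p i u yt).
Hypothesis p_gt0 : forall i u yt y, 0 < p i u yt y.
Hypothesis c_gt0 : forall u, 0 < c u.
Local Notation hst := (seq (Y * U)).
Variable t : seq_test p y0.
Local Notation P i := (prob t i).
Local Notation X := (proc_of t).
Local Notation N := (stop_of t).
Local Notation phi := (policy t).

Lemma histS n w : hist X n.+1 w = rcons (hist X n w) (X n w).
Proof. exact: mkseqS. Qed.

Lemma size_hist n w : size (hist X n w) = n.
Proof. exact: size_mkseq. Qed.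

Lemma measurable_hist n h : measurable [set w | hist X n w = h].
Proof.
elim: n h => [|n IH] h.
  case: h => [|z h]; first by rewrite (_ : [set _ | _] = setT) // -subTset.
  by rewrite (_ : [set _ | _] = set0) // -subset0.
case/lastP: h => [|h z].
  rewrite (_ : [set _ | _] = set0) // -subset0 => w /= /(congr1 size).
  by rewrite size_hist.
rewrite (_ : [set _ | _] = [set w | hist X n w = h] `&` X n @^-1` [set z]).
  by apply: measurableI => //; exact: proc_measurable.
apply/seteqP; split=> w /=; rewrite histS; first by move=> /rcons_inj[-> ->].
by move=> [-> ->].
Qed.

(** There are only finitely many histories of each length, so that integrals
    of functions of the history become finite sums. *)
Lemma fun_histE (F : hst -> R) n w : (F (hist X n w))%:E =
  (\sum_(h <- words (Y * U)%type n) (F h)%:E * (\1_[set w | hist X n w = h] w)%:E)%E.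
Proof.
rewrite (bigD1_seq (hist X n w)) ?words_uniq ?mem_words ?size_hist //=.
rewrite indicE mem_set // mule1 big1 ?adde0 // => h.
rewrite eq_sym => /eqP neq; rewrite indicE memNset // mule0.
by [].
Qed.

Lemma measurable_fun_hist (F : hst -> R) n :
  measurable_fun setT ((fun w => (F (hist X n w))%:E) : Defs.space t -> \bar R).
Proof.
under eq_fun do rewrite fun_histE.
apply: emeasurable_sum => h _; apply: measurable_funeM => //.
by apply/measurable_EFinP; apply: measurable_indic; exact: measurable_hist.
Qed.

Lemma measurable_hist_pred (B : pred hst) n : measurable [set w | B (hist X n w)].
Proof.
rewrite (_ : [set _ | _] = \big[setU/set0]_(h <- words (Y * U)%type n | B h)
    [set w | hist X n w = h]).
  by apply: bigsetU_measurable => h _; exact: measurable_hist.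
apply/seteqP; split => w /=.
  move=> Bw; rewrite -bigcup_seq_cond; exists (hist X n w) => //=.
  by rewrite mem_words size_hist eqxx.
by rewrite -bigcup_seq_cond => -[h /= /andP[_ Bh] ->].
Qed.

Lemma integral_hist i (F : hst -> R) n : (forall h, 0 <= F h) ->
  (\int[P i]_w (F (hist X n w))%:E = (expect p y0 phi i n F)%:E)%E.
Proof.
move=> F0; under eq_integral do rewrite fun_histE.
rewrite ge0_integral_sum //; last 2 first.
- move=> h; apply: measurable_funeM; apply/measurable_EFinP.
  by apply: measurable_indic; exact: measurable_hist.
- by move=> h w _; rewrite mule_ge0 // lee_fin.
rewrite /expect -sumEFin; apply: eq_big_seq => h.
rewrite mem_words => /eqP hn; rewrite ge0_integralZl_EFin //; last first.
  by apply/measurable_EFinP; apply: measurable_indic; exact: measurable_hist.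
rewrite integral_indic //; last exact: measurable_hist.
rewrite setIT [_ * F h]mulrC EFinM; congr (_ * _)%E.
by have := proc_law t i h; rewrite hn.
Qed.

Lemma prob_hist i (B : pred hst) n :
  (P i [set w | B (hist X n w)] = (expect p y0 phi i n (fun h => (B h)%:R))%:E)%E.
Proof.
rewrite -integral_hist // -[X in P i X]setIT -integral_indic //; last first.
  exact: measurable_hist_pred.
apply: eq_integral => w _; rewrite indicE; congr ((_ : bool)%:R)%:E.
by apply/idP/idP => [/set_mem|Bw] //; apply/mem_set.
Qed.

(** Whether the test has stopped by time [n] is decided by the history of
    length [n]; since a history determines its length, the sets obtained for
    the various [n] can be merged into one. *)
Lemma stop_first_time : exists S : pred hst, forall w,
  N w = first_time (fun n => S (hist X n w)).
Proof.
have /choice[B BP] : forall n, exists B : set hst, forall w,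
    time_le (N w) n = `[< B (hist X n w) >].
  move=> n; have [B _ BE] := stopP t n; exists B => w.
  apply/idP/asboolP => [le_n|Bw]; last first.
    by have : (setT `&` hist X n @^-1` B) w by []; rewrite BE.
  by have : [set w | time_le (N w) n] w by []; rewrite -BE => -[].
exists (fun h => `[< B (size h) h >]) => w; apply: first_timeP => n.
  by rewrite BP => Bn; exists n => //; rewrite size_hist.
by rewrite size_hist BP.
Qed.

Section Stopped.
Variable S : pred hst.
Hypothesis stopE : forall w, N w = first_time (fun n => S (hist X n w)).

Lemma stop_some w m : N w = Some m ->
  S (hist X m w) /\ forall k, (k < m)%N -> ~~ S (hist X k w).
Proof.
rewrite stopE /first_time; case: pselect => // exS.
case: ex_minnP => k Sk kmin [<-]; split=> // l lk.
by apply/negP => /kmin; rewrite leqNgt lk.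
Qed.

Lemma stop_none w : N w = None -> forall k, ~~ S (hist X k w).
Proof.
rewrite stopE /first_time; case: pselect => // nS _ k.
by apply/negP => Sk; apply: nS; exists k.
Qed.

Lemma stopped_hist n w : stopped S (hist X n w) =
  hist X (if N w is Some m then minn m n else n) w.
Proof.
case stop_w : (N w) => [m|]; last first.
  by elim: n => // n IH; rewrite histS stopped_rcons IH (negPf (stop_none stop_w n)).
have [Sm nS] := stop_some stop_w.
elim: n => [|n IH]; first by rewrite minn0.
rewrite histS stopped_rcons IH; have [mn|nm] := leqP m n.
  by rewrite Sm (minn_idPl (leqW mn)).
by rewrite (negPf (nS n nm)) -histS (minn_idPr nm).
Qed.

Lemma running_hist n w : time_gt (N w) n = ~~ S (stopped S (hist X n w)).
Proof.
rewrite stopped_hist; case stop_w : (N w) => [m|] /=.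
  have [Sm nS] := stop_some stop_w; have [mn|nm] := leqP m n.
    by rewrite Sm.
  by rewrite nS.
by rewrite (stop_none stop_w).
Qed.

(* The cost of the last control of a history, if the test is still running one
   step earlier; reversal gives access to the last entry. *)
Let running_cost (g : hst) : R :=
  if rev g is z :: r then (~~ S (stopped S (rev r)))%:R * c z.2 else 0.

Let expected_costE i : expected_cost c t i = (\sum_(k <oo)
  (expect p y0 phi i k (fun h => (~~ S (stopped S h))%:R * \sum_u phi h u * c u))%:E)%E.
Proof.
have rc0 g : 0 <= running_cost g.
  by rewrite /running_cost; case: rev => // z r; rewrite mulr_ge0 // ltW.
transitivity (\int[P i]_w \sum_(k <oo) (running_cost (hist X k.+1 w))%:E)%E.
  apply: eq_integral => w _; rewrite /total_cost eseries_mkcond.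
  apply: eq_eseriesr => k _; rewrite histS /running_cost rev_rcons revK.
  by rewrite running_hist; case: ifP; rewrite ?mul1r ?mul0r.
rewrite integral_nneseries //; last 2 first.
- by move=> k; exact: measurable_fun_hist.
- by move=> k w _; rewrite lee_fin.
apply: eq_eseriesr => k _; rewrite integral_hist // expectS; congr EFin.
apply: eq_expect => h _; rewrite /step mulr_sumr; apply: eq_bigr => u _.
under eq_bigr do rewrite /running_cost rev_rcons revK /=.
by rewrite -mulr_suml (p_pmf _ _ _).2 mul1r mulrCA.
Qed.

Let cost_ge0 i k : 0 <= expect p y0 phi i k
  (fun h => (~~ S (stopped S h))%:R * \sum_u phi h u * c u).
Proof.
apply: expect_ge0 => //; first exact: policyP.
move=> h; rewrite mulr_ge0 // sumr_ge0 // => u _.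
by rewrite mulr_ge0 ?(policyP t h).1 // ltW.
Qed.

Let run_costE i n :
  (run_sum p y0 phi i S n (fun h => \sum_u phi h u * c u))%:E
  = (\sum_(0 <= k < n) (expect p y0 phi i k
      (fun h => (~~ S (stopped S h))%:R * \sum_u phi h u * c u))%:E)%E.
Proof. by rewrite big_mkord sumEFin. Qed.

Lemma run_cost_le i n :
  ((run_sum p y0 phi i S n (fun h => \sum_u phi h u * c u))%:E
    <= expected_cost c t i)%E.
Proof.
rewrite expected_costE run_costE; apply: nneseries_lim_ge => k _ _.
by rewrite lee_fin.
Qed.

Lemma expected_cost_bound i (B : R) :
  (forall n, run_sum p y0 phi i S n (fun h => \sum_u phi h u * c u) <= B) ->
  (expected_cost c t i <= B%:E)%E.
Proof.
move=> leB; rewrite expected_costE; apply: lime_le.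
  by apply: is_cvg_nneseries => k _ _; rewrite lee_fin.
by apply: nearW => n; rewrite -run_costE lee_fin.
Qed.

Section Decided.
Variable Q : pred 'I_M.

Definition decided : set (Defs.space t) :=
  [set w | exists2 n, N w = Some n & Q (decision t (hist X n w))].

Let D (h : hst) := S h && Q (decision t h).

Let decidedE : decided = \bigcup_n [set w | D (stopped S (hist X n w))].
Proof.
apply/seteqP; split=> w /=.
  move=> [n stop_w Qw]; exists n => //=; rewrite /D stopped_hist stop_w minnn Qw.
  by rewrite (stop_some stop_w).1.
move=> [n _ /= /andP[]]; rewrite stopped_hist; case stop_w : (N w) => [m|].
  have [Sm nS] := stop_some stop_w; have [mn|nm] := leqP m n.
    by move=> _ Qw; exists m.
  by rewrite (negPf (nS n nm)).
by rewrite (negPf (stop_none stop_w n)).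
Qed.

Lemma measurable_decided : measurable decided.
Proof.
rewrite decidedE; apply: bigcupT_measurable => n.
exact: (measurable_hist_pred (fun h => D (stopped S h))).
Qed.

Lemma prob_decided_ge i n :
  ((expect p y0 phi i n (fun h => (D (stopped S h))%:R))%:E <= P i decided)%E.
Proof.
rewrite -(prob_hist i (fun h => D (stopped S h))); apply: le_measure.
- by rewrite inE; exact: (measurable_hist_pred (fun h => D (stopped S h))).
- by rewrite inE; exact: measurable_decided.
- by rewrite decidedE => w Dw; exists n.
Qed.

Lemma prob_decided_le i (x : R) :
  (forall n, expect p y0 phi i n (fun h => (D (stopped S h))%:R) <= x) ->
  (P i decided <= x%:E)%E.
Proof.
move=> le_x; pose A n := [set w | D (stopped S (hist X n w))].
have ndA : nondecreasing_seq A.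
  apply/nondecreasing_seqP => n; apply/subsetPset => w; rewrite /A /=.
  rewrite histS stopped_rcons; case: ifPn => // nS.
  by rewrite /D (negPf nS).
have mA n : measurable (A n).
  exact: (measurable_hist_pred (fun h => D (stopped S h))).
have := @nondecreasing_cvg_mu _ _ _ (P i) A mA (bigcupT_measurable A mA) ndA.
rewrite -decidedE => cvgA; rewrite -(cvg_lim _ cvgA) //; apply: lime_le.
  by apply/cvg_ex; exists (P i decided).
apply: nearW => n /=; rewrite /A.
by rewrite (prob_hist i (fun h => D (stopped S h))) lee_fin.
Qed.

End Decided.

End Stopped.

Lemma acceptsE i : accepts_of t i = decided (pred1 i).
Proof. by apply/seteqP; split=> w [n ? /= /eqP ?]; exists n => //=; apply/eqP. Qed.

Lemma errsE i : errs_of t i = decided (predC1 i).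
Proof. by apply/seteqP; split=> w [n ? /= /eqP ?]; exists n => //=; apply/eqP. Qed.

End Bridge.

(** * The converse for sequential tests *)

Section TestConverse.
Variables (R : realType) (Y U : finType) (M : nat).
Variables (p : 'I_M -> U -> Y -> Y -> R) (y0 : Y) (c : U -> R).
Hypothesis p_pmf : forall i u yt, is_pmf (p i u yt).
Hypothesis p_gt0 : forall i u yt y, 0 < p i u yt y.
Hypothesis c_gt0 : forall u, 0 < c u.

(** To err under [k] is to accept some [j] other than [k]. *)
Lemma errs_le (t : seq_test p y0) k (x : 'I_M -> R) :
  (forall j, j != k -> (prob t k (accepts_of t j) <= (x j)%:E)%E) ->
  (prob t k (errs_of t k) <= (\sum_(j | j != k) x j)%:E)%E.
Proof.
move=> le_x; have [S stopE] := stop_first_time t.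
rewrite errsE; apply: (prob_decided_le stopE) => n.
apply: (@le_trans _ _ (\sum_(j | j != k) expect p y0 (policy t) k n
    (fun h => (S (stopped S h) && pred1 j (decision t (stopped S h)))%:R))).
  rewrite -expect_sum; apply: le_expect => // [|h _ _]; first exact: policyP.
  have [Sh|Sh] /= := boolP (S _); last by rewrite sumr_ge0.
  have [-> |neq] := eqVneq (decision t (stopped S h)) k; first by rewrite sumr_ge0.
  by rewrite (bigD1 (decision t (stopped S h))) //= eqxx lerDl sumr_ge0.
apply: ler_sum => j jk; rewrite -lee_fin; apply: le_trans (le_x j jk).
by rewrite acceptsE; exact: (prob_decided_ge stopE (pred1 j)).
Qed.

(** A finite expected cost forces the test to stop with probability 1, so that
    what is not an error is a correct decision. *)
Lemma converse_test i qs : (1 < M)%N -> attains_dstar p c i qs ->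
  exists2 C : R, 0 <= C & forall (t : seq_test p y0) (E s e : R), 0 <= s ->
    (expected_cost c t i <= E%:E)%E ->
    (forall j, j != i -> ((expR s)%:E * prob t j (accepts_of t i) <= 1)%E) ->
    (prob t i (errs_of t i) <= e%:E)%E ->
    s * (1 - e) <= fine (dstar p c i) * E + C.
Proof.
move=> M1 qs_opt; have [C C0 conv] := converse_finite y0 p_pmf p_gt0 M1 qs_opt c_gt0.
exists C => // t E s e s0 leE acc_le err_le.
have [S stopE] := stop_first_time t; have phiP := policyP t.
have [d [d0 dE _ _]] := dstar_value y0 p_pmf p_gt0 c_gt0 M1 qs_opt.
rewrite dE /= in conv *.
have [cm cm0 cm_le] := fin_lower_bound c_gt0.
pose r n := expect p y0 (policy t) i n (fun h => (~~ S (stopped S h))%:R).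
have cost_le n : run_sum p y0 (policy t) i S n (fun h => \sum_u policy t h u * c u) <= E.
  rewrite -lee_fin; apply: le_trans leE.
  exact: (run_cost_le p_pmf p_gt0 c_gt0 stopE).
have r_decr : {homo r : m n / (m <= n)%N >-> n <= m}.
  by apply/nonincreasing_seqP => n; exact: expect_running_decr.
have r_le n : n%:R * (cm * r n) <= E.
  apply: le_trans (cost_le n).
  rewrite mulr_natl -[X in _ *+ X]card_ord -sumr_const; apply: ler_sum => k _.
  apply: (@le_trans _ _ (cm * r k)).
    by rewrite ler_pM2l //; apply: r_decr; exact: ltnW.
  rewrite -expectZ; apply: le_expect => // h _ _; rewrite mulrC ler_wpM2l //.
  rewrite -[leLHS]mul1r -(phiP h).2 mulr_suml; apply: ler_sum => u _.
  by rewrite ler_wpM2l ?(phiP h).1.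
have E0 : 0 <= E by have := r_le 0%N; rewrite mul0r.
have key n : s * (1 - e - r n) <= d * E + C.
  apply: (@le_trans _ _ (s * expect p y0 (policy t) i n
      (fun h => (S (stopped S h) && pred1 i (decision t (stopped S h)))%:R))).
    rewrite ler_wpM2l //.
    have : expect p y0 (policy t) i n
        (fun h => (S (stopped S h) && predC1 i (decision t (stopped S h)))%:R) <= e.
      rewrite -lee_fin; apply: le_trans err_le; rewrite errsE.
      exact: (prob_decided_ge stopE (predC1 i)).
    have : 1 <= expect p y0 (policy t) i n
        (fun h => (S (stopped S h) && pred1 i (decision t (stopped S h)))%:R
          + (S (stopped S h) && predC1 i (decision t (stopped S h)))%:R
          + (~~ S (stopped S h))%:R).
      rewrite -[leLHS](expect_cst y0 p_pmf phiP i n); apply: le_expect => // h _ _.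
      by case: (S _) => /=; case: (eqVneq (decision t (stopped S h)) i) => _ /=; lra.
    by rewrite !expectD /r; lra.
  apply: le_trans (conv _ phiP S
    (fun h => S h && pred1 i (decision t h)) n s s0 _) _.
    move=> j ji; rewrite -lee_fin; apply: le_trans (acc_le j ji).
    rewrite EFinM lee_pmul2l ?lte_fin ?expR_gt0 // acceptsE.
    exact: (prob_decided_ge stopE (pred1 i)).
  by rewrite lerD2r ler_wpM2l.
(* The test is still running at time [n] with probability [r n = O(1 / n)], so
   the term [s * r n] of [key] falls below any positive gap [g]. *)
rewrite leNgt; apply/negP => lt1.
pose g := s * (1 - e) - (d * E + C); have g0 : 0 < g by rewrite subr_gt0.
pose n := (Num.truncn (s * E / (g * cm))).+1.
have : s * E / (g * cm) < n%:R by exact: truncnS_gt.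
rewrite ltr_pdivrMr ?mulr_gt0 // => lt2.
have gr : g <= s * r n by have := key n; rewrite /g mulrBr; lra.
have n0 : 0 < n%:R :> R by rewrite ltr0n.
have : n%:R * cm * g <= n%:R * cm * (s * r n) by rewrite ler_pM2l ?mulr_gt0.
have : s * (n%:R * (cm * r n)) <= s * E by rewrite ler_wpM2l.
by move: lt2; move: (n%:R : R) (r n) => m v; lra.
Qed.

End TestConverse.

(** * The proposed test *)

Section ProposedTest.
Variables (R : realType) (Y U : finType) (M : nat).
Variables (p : 'I_M -> U -> Y -> Y -> R) (y0 : Y) (c : U -> R).
Hypothesis p_pmf : forall i u yt, is_pmf (p i u yt).
Hypothesis p_gt0 : forall i u yt y, 0 < p i u yt y.
Hypothesis c_gt0 : forall u, 0 < c u.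
Local Notation hst := (seq (Y * U)).
Variables (a : R) (qs : 'I_M -> Y -> U -> R) (ihat : hst -> 'I_M).
Hypothesis qsP : forall i, is_cond_pmf (qs i).
Hypothesis ihatP : is_ML p y0 a qs ihat.
Local Notation phi := (policy_star y0 a qs ihat).
Variables (r : 'I_M -> R) (t : seq_test p y0).
Hypothesis r_gt0 : forall i, 0 < r i.
Hypothesis tP : is_proposed_test a qs ihat r t.

Let phiP : is_policy phi. Proof. exact: policy_star_is_policy. Qed.

Definition stop_rule (h : hst) : bool :=
  (0 < size h)%N && ((r (ihat h))^-1 < likelihood_ratio p y0 a qs ihat h).

Lemma proposed_stop w :
  stop_of t w = first_time (fun n => stop_rule (hist (proc_of t) n w)).
Proof.
have [_ -> _] := tP; rewrite /stop_star; congr first_time.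
by apply/funext => n; rewrite /stop_rule size_hist.
Qed.

Lemma proposed_policy : policy t = phi.
Proof. by have [pE _ _] := tP; apply/funext => h; apply/funext => u; exact: pE. Qed.

(** The likelihood ratio of the stopping rule has the largest competing
    likelihood in its denominator, and the policy factor cancels. *)
Lemma stop_rule_lik h j : 0 < pol_weight phi h -> stop_rule h -> j != ihat h ->
  lik p y0 j h <= r (ihat h) * lik p y0 (ihat h) h.
Proof.
move=> h0 /andP[_]; set m := ihat h => + jm; rewrite /likelihood_ratio -/m.
set b := \big[_/_]_(_ < _ | _) _ => lt1.
have j_le : joint_pmf p y0 phi j h <= b by exact: le_bigmax_cond.
have j_gt0 : 0 < joint_pmf p y0 phi j h by rewrite joint_pmfE mulr_gt0 // lik_gt0.
have b0 : 0 < b by exact: lt_le_trans j_le.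
rewrite ltr_pdivlMr // in lt1.
rewrite -(ler_pM2r h0) -mulrA -!joint_pmfE; apply: (le_trans j_le).
by rewrite -(ler_pM2l (x := (r m)^-1)) ?invr_gt0 // mulKf ?gt_eqF // ltW.
Qed.

(** Conversely, the test has stopped at the latest when all log-likelihood
    ratios of [i] exceed [- ln (r i)], since [i] is then the estimate. *)
Lemma stop_rule_llr i h : (1 < M)%N -> r i <= 1 -> 0 < pol_weight phi h ->
  (0 < size h)%N -> (forall j, j != i -> - ln (r i) < llr p y0 i j h) ->
  stop_rule h.
Proof.
move=> M1 ri1 h0 hn llr_gt.
have lik_lt j : j != i -> lik p y0 j h < r i * lik p y0 i h.
  move=> ji; have lt1 : expR (- ln (r i)) < expR (llr p y0 i j h).
    by rewrite ltr_expR llr_gt.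
  rewrite expRN /llr !lnK ?posrE ?divr_gt0 ?lik_gt0 // in lt1.
  by rewrite ltr_pdivlMr ?lik_gt0 // mulrC ltr_pdivrMr // mulrC in lt1.
have ihat_i : ihat h = i.
  apply/eqP/negPn/negP => neq; have := ihatP h i; rewrite !joint_pmfE ler_pM2r //.
  have le1 : r i * lik p y0 i h <= lik p y0 i h.
    by rewrite ler_piMl // ltW // lik_gt0.
  by move=> le2; have := lt_le_trans (lik_lt _ neq) (le_trans le1 le2); rewrite ltxx.
rewrite /stop_rule hn /likelihood_ratio ihat_i /=.
have [j0 j0i] : exists j0, j0 != i.
  by have [j [ji _ _]] := reward_attained y0 p_pmf p_gt0 c_gt0 i M1 (qsP i); exists j.
have b_gt0 : 0 < \big[Num.max/0]_(j < M | j != i) joint_pmf p y0 phi j h.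
  have := @le_bigmax_cond _ _ _ (0 : R) j0 [pred j | j != i]
    (fun j => joint_pmf p y0 phi j h) j0i.
  by apply: lt_le_trans; rewrite joint_pmfE mulr_gt0 // lik_gt0.
rewrite ltr_pdivlMr // mulrC ltr_pdivrMr // mulrC.
apply: bigmax_lt => [|j ji].
  by rewrite mulr_gt0 // joint_pmfE mulr_gt0 // lik_gt0.
by rewrite !joint_pmfE mulrA ltr_pM2r // lik_lt.
Qed.

(** The bound on likelihoods at acceptance is integrated by a change of
    measure. *)
Lemma proposed_accepts_le i j : j != i ->
  (prob t j (accepts_of t i) <= (r i)%:E)%E.
Proof.
move=> ji; rewrite acceptsE; apply: (prob_decided_le proposed_stop) => n.
have [_ _ decE] := tP; rewrite proposed_policy.
under eq_expect => h _ do rewrite decE.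
rewrite -(change_of_measure y0 p_pmf p_gt0 phiP stop_rule i j n
  (fun h => (stop_rule h && (ihat h == i))%:R)).
rewrite -[leRHS](expect_cst y0 p_pmf phiP i n); apply: le_expect => // h _ h0.
case: (boolP (_ && _)) => [/andP[Sh /eqP ih]|_]; last by rewrite mulr0 ltW.
rewrite mulr1 ler_pdivrMr ?lik_gt0 // -{1 2}ih.
by apply: stop_rule_lik => //; [exact: pol_weight_gt0_stopped|rewrite ih].
Qed.

Lemma proposed_risk i : (risk t i <= (r i)%:E)%E.
Proof.
apply: bigmax_le => [|j ji]; first by rewrite lee_fin ltW.
exact: proposed_accepts_le.
Qed.

End ProposedTest.

(** * Asymptotics *)

Section Vanishing.
Variables (R : realType) (M : nat) (K : R).

Lemma near_vanishing (Q : set ('I_M -> R)) (e : R) : 0 < e ->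
  (forall r, (forall i, 0 < r i) -> (forall i, r i < e) ->
     (forall i j, r i <= K * r j) -> Q r) ->
  vanishing K Q.
Proof.
move=> e0 rQ; exists e => // r [r0 re rK].
have le_max j : ((r j)%:E <= \big[maxe/0]_(i < M) (r i)%:E)%E.
  exact: (le_bigmax _ (fun i => (r i)%:E)).
apply: rQ => // [j|j k]; first by rewrite -lte_fin (le_lt_trans (le_max j)).
have [|l _ minE] := eq_bigmin (x := +oo%E) j predT (fun i => (r i)%:E) isT.
  by move=> *; rewrite leey.
have rKl m : r m <= K * r l.
  rewrite -lee_fin EFinM -minE; exact: le_trans (le_max m) rK.
have K0 : 0 < K by rewrite -(pmulr_lgt0 _ (r0 l)) (lt_le_trans (r0 l)).
apply: le_trans (rKl j) _; rewrite ler_pM2l // -lee_fin -minE.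
exact: (bigmin_le _ k (fun i => (r i)%:E)).
Qed.

Lemma vanishing_filter : Filter (@vanishing R M K).
Proof.
apply: filter_from_filter; first by exists 1 => /=.
move=> e f e0 f0; exists (Num.min e f); first by rewrite /= lt_min e0.
move=> r [r0 rlt rK]; split; split=> //; apply: (lt_le_trans rlt);
  by rewrite lee_fin ge_min lexx ?orbT.
Qed.

End Vanishing.

Section AsympEq.
Variables (R : realType) (T : Type) (F : set_system T).
Context {FF : Filter F}.

Lemma asymp_eq_ratio (A B : T -> \bar R) :
  (forall eta : R, 0 < eta -> F [set r | exists x y : R,
     [/\ A r = x%:E, B r = y%:E, 0 < y & `|x - y| <= eta * y]]) ->
  asymp_eq F A B.
Proof.
move=> AB; exists (fun r => fine (A r) / fine (B r) - 1).
  apply/cvgrPdist_le => eta eta0; apply: filterS (AB eta eta0) => r.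
  move=> [x [y [-> -> y0 le_eta]]] /=; rewrite sub0r normrN.
  have -> : x / y - 1 = (x - y) / y by rewrite mulrBl divff // gt_eqF.
  by rewrite normrM normfV (gtr0_norm y0) ler_pdivrMr.
apply: filterS (AB 1 ltr01) => r [x [y [-> -> y0 _]]] /=.
by rewrite -EFinM subrKC mulrC divfK // gt_eqF.
Qed.

Lemma asymp_eq_pinfty (A B : T -> \bar R) :
  F [set r | A r = +oo%E /\ B r = +oo%E] -> asymp_eq F A B.
Proof.
move=> AB; exists (fun=> 0); first exact: cvg_cst.
by apply: filterS AB => r [-> ->]; rewrite addr0 mule1.
Qed.

End AsympEq.

(** A family of tests [t_] with thresholds [b] tending to infinity, compared
    with the tests of a class [cls r] whose probability of wrongly accepting
    [i] is at most [v r]. *)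
Section Sandwich.
Variables (R : realType) (Y U : finType) (M : nat).
Variables (p : 'I_M -> U -> Y -> Y -> R) (y0 : Y) (c : U -> R).
Hypothesis p_pmf : forall i u yt, is_pmf (p i u yt).
Hypothesis p_gt0 : forall i u yt y, 0 < p i u yt y.
Hypothesis c_gt0 : forall u, 0 < c u.
Hypothesis M_gt1 : (1 < M)%N.
Variables (i : 'I_M) (qs : Y -> U -> R).
Hypothesis qs_opt : attains_dstar p c i qs.
Variables (T : Type) (F : set_system T).
Context {FF : Filter F}.
Variables (t_ : T -> seq_test p y0) (b : T -> R) (v : T -> \bar R).
Variables (cls : T -> seq_test p y0 -> Prop) (c0 : R).
Hypothesis b_cvg : forall B : R, F [set r | B <= b r].
Hypothesis v_ge0 : forall r, (0 <= v r)%E.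
Hypothesis v_le : F [set r | (v r <= (expR (c0 - b r))%:E)%E].
Hypothesis cls_acc : forall r t, cls r t ->
  forall j, j != i -> (prob t j (accepts_of t i) <= v r)%E.
Hypothesis cls_err : forall e : R, 0 < e -> F [set r | forall t, cls r t ->
  (prob t i (errs_of t i) <= e%:E)%E].
Hypothesis cls_t : forall r, cls r (t_ r).
Hypothesis cost_upper : (0 < dstar p c i)%E -> forall delta : R, 0 < delta ->
  exists C : R, F [set r | (expected_cost c (t_ r) i
    <= (((1 + delta) * b r + C) / fine (dstar p c i))%:E)%E].

Let expected_cost_ge0 (t : seq_test p y0) : (0 <= expected_cost c t i)%E.
Proof.
have [S stopE] := stop_first_time t.
by have := run_cost_le p_pmf p_gt0 c_gt0 stopE i 0; rewrite /run_sum big_ord0.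
Qed.

Let v_small (s : R) : F [set r | ((expR s)%:E * v r <= 1)%E].
Proof.
apply: filterS2 v_le (b_cvg (c0 + s)) => r /= v_le_r b_ge.
apply: (@le_trans _ _ ((expR s)%:E * (expR (c0 - b r))%:E)%E).
  by rewrite lee_pmul2l // lte_fin expR_gt0.
by rewrite -EFinM lee_fin -expRD expR_le1; lra.
Qed.

(** The converse with [dstar = 0] bounds [s] by a constant as soon as the
    expected cost is finite, which is absurd once [v r] is small. *)
Lemma sandwich_indistinguishable : dstar p c i = 0%E ->
  asymp_eq F (fun r => expected_cost c (t_ r) i)
             (fun r => (- lne (v r) / dstar p c i)%E) /\
  asymp_eq F (fun r => expected_cost c (t_ r) i)
             (fun r => inf_cost c (cls r) i).
Proof.
move=> d0; have [C C0 conv] := converse_test y0 p_pmf p_gt0 c_gt0 M_gt1 qs_opt.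
have infinite : F [set r | forall t, cls r t -> expected_cost c t i = +oo%E].
  have half0 : 0 < 2^-1 :> R by [].
  apply: filterS2 (v_small (2 * (C + 1))) (cls_err half0) => r /= v_le_r err_le t cls_t'.
  have := expected_cost_ge0 t; case E_t : (expected_cost c t i) => [E| |] // _.
  have : 2 * (C + 1) * (1 - 2^-1) <= fine (dstar p c i) * E + C.
    apply: (conv t E _ _ _ _ _ (err_le t cls_t')).
    - by rewrite mulr_ge0 // addr_ge0.
    - by rewrite E_t.
    - move=> j ji; apply: le_trans v_le_r; rewrite lee_pmul2l ?lte_fin ?expR_gt0 //.
      exact: cls_acc.
  move=> le1; exfalso; rewrite d0 /= mul0r in le1; clear d0; lra.
split; apply: asymp_eq_pinfty.
  apply: filterS2 infinite (v_small 1) => r /= inf_r v_le_r; split; first exact: inf_r.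
  rewrite d0 inve0 gt0_muley // oppe_gt0 lne_lt0.
  apply: (@le_lt_trans _ _ (expR (- 1))%:E); last first.
    by rewrite lte_fin expR_lt1 oppr_lt0.
  move: v_le_r (v_ge0 r); case: (v r) => [w| |] //=.
    by rewrite -EFinM !lee_fin mulrC expRN -ler_pdivlMr ?expR_gt0 // div1r.
  by rewrite gt0_muley ?lte_fin ?expR_gt0 // leye_eq.
apply: filterS infinite => r /= inf_r; split; first exact: inf_r.
by apply/ereal_inf_pinfty => _ [t cls_t' ->]; exact: inf_r.
Qed.

Let fin_between (x : \bar R) (l u : R) :
  (l%:E <= x)%E -> (x <= u%:E)%E -> exists2 x' : R, x = x'%:E & l <= x' <= u.
Proof.
by case: x => // x'; rewrite !lee_fin => lx xu; exists x' => //; rewrite lx.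
Qed.

(* All quantities to be compared, in terms of [beta = - ln (v r)]. *)
Let core : (0 < dstar p c i)%E -> forall delta : R, 0 < delta ->
  exists2 C : R, 0 <= C & forall e B : R, 0 < e < 1 ->
  F [set r | exists x I beta : R,
    [/\ expected_cost c (t_ r) i = x%:E, inf_cost c (cls r) i = I%:E,
        v r = (expR (- beta))%:E, B <= beta &
        [/\ beta * (1 - e) - C <= fine (dstar p c i) * I, I <= x &
            fine (dstar p c i) * x <= (1 + delta) * beta + C]]].
Proof.
move=> d_gt0 delta delta0; have [C1 upper] := cost_upper d_gt0 delta0.
have [C2 C2_ge0 conv] := converse_test y0 p_pmf p_gt0 c_gt0 M_gt1 qs_opt.
have [d [_ dE _ _]] := dstar_value y0 p_pmf p_gt0 c_gt0 M_gt1 qs_opt.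
rewrite dE /= in d_gt0 upper conv *; rewrite lte_fin in d_gt0.
exists (`|(1 + delta) * c0| + `|C1| + C2); first by rewrite !addr_ge0.
move=> e B /andP[e0 e1].
apply: filterS3 (filterI upper v_le) (cls_err e0) (b_cvg (`|B| + c0)).
move=> r /= [x_le v_le_r] err_le b_ge.
have [x xE /andP[x0 x_le']] := fin_between (expected_cost_ge0 (t_ r)) x_le.
have [w wE /andP[w0 w_le]] := fin_between (v_ge0 r) v_le_r.
have conv_r t (E s : R) : cls r t -> 0 <= s -> (expected_cost c t i <= E%:E)%E ->
    expR s * w <= 1 -> s * (1 - e) <= d * E + C2.
  move=> cls_t' s0 leE sw; apply: (conv t E s e s0 leE) => [j ji|]; last exact: err_le.
  apply: (@le_trans _ _ ((expR s)%:E * w%:E)%E); last by rewrite -EFinM lee_fin.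
  by rewrite lee_pmul2l ?lte_fin ?expR_gt0 // -wE cls_acc.
have w_gt0 : 0 < w.
  rewrite lt0r w0 andbT; apply/eqP => w_eq0.
  have dx0 : 0 <= d * x by rewrite mulr_ge0 // ltW.
  have e10 : 0 < 1 - e by rewrite subr_gt0.
  pose s := (d * x + C2 + 1) / (1 - e).
  have s0 : 0 <= s by apply: divr_ge0; [rewrite !addr_ge0|exact: ltW].
  have := conv_r (t_ r) x s (cls_t r) s0; rewrite xE w_eq0 mulr0 => /(_ (lexx _) ler01).
  by rewrite /s divfK ?gt_eqF //; lra.
pose beta := - ln w.
have beta_ge : b r - c0 <= beta.
  rewrite /beta -opprB lerN2 -[leRHS]expRK ler_ln ?posrE ?expR_gt0 //.
have expR_beta : expR beta * w = 1.
  by rewrite /beta expRN lnK ?posrE // mulVf // gt_eqF.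
have beta_B : `|B| <= beta by lra.
have beta0 : 0 <= beta by exact: le_trans beta_B.
have x_inf : (inf_cost c (cls r) i <= x%:E)%E.
  by apply: ereal_inf_lbound; exists (t_ r); [exact: cls_t|rewrite xE].
have inf_ge : (((beta * (1 - e) - C2) / d)%:E <= inf_cost c (cls r) i)%E.
  apply/ereal_infP => _ [t cls_t' ->].
  have := expected_cost_ge0 t; case E_t : (expected_cost c t i) => [E| |] // _.
    rewrite lee_fin ler_pdivrMr // [E * d]mulrC lerBlDr.
    by apply: (conv_r t) => //; rewrite ?E_t ?expR_beta.
  by rewrite leey.
have [I IE /andP[I_ge I_le]] := fin_between inf_ge x_inf.
exists x, I, beta; split=> //.
- by rewrite wE /beta opprK lnK ?posrE.
- exact: le_trans (ler_norm B) beta_B.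
rewrite ler_pdivrMr // in I_ge; rewrite ler_pdivlMr // in x_le'.
have := ler_norm C1; have := ler_norm ((1 + delta) * c0).
have := normr_ge0 C1; have := normr_ge0 ((1 + delta) * c0).
have : (1 + delta) * b r <= (1 + delta) * (beta + c0).
  by rewrite ler_pM2l ?addr_gt0 //; lra.
by move=> ? ? ? ? ?; split=> //; lra.
Qed.

(** With [beta = - ln (v r)] tending to infinity, [core] confines the cost and
    its infimum to [beta / dstar] up to a factor close to 1. *)
Lemma sandwich_distinguishable : (0 < dstar p c i)%E ->
  asymp_eq F (fun r => expected_cost c (t_ r) i)
             (fun r => (- lne (v r) / dstar p c i)%E) /\
  asymp_eq F (fun r => expected_cost c (t_ r) i)
             (fun r => inf_cost c (cls r) i).
Proof.
move=> d_gt0.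
have [d [_ dE _ _]] := dstar_value y0 p_pmf p_gt0 c_gt0 M_gt1 qs_opt.
have d0 : 0 < d by rewrite -lte_fin -dE.
suff main (eta : R) : 0 < eta -> F [set r | exists x I beta : R,
    [/\ expected_cost c (t_ r) i = x%:E, inf_cost c (cls r) i = I%:E,
        v r = (expR (- beta))%:E, 0 < beta /\ 0 < I &
        `|x - beta / d| <= eta * (beta / d) /\ `|x - I| <= eta * I]].
  split; apply: asymp_eq_ratio => eta /main;
    apply: filterS => r [x [I [beta [xE IE vE [beta0 I0] [le1 le2]]]]]; exists x.
    exists (beta / d); split=> //; last exact: divr_gt0.
    rewrite vE dE lne_EFin ?expR_gt0 // expRK EFinN oppeK inver gt_eqF //.
  by exists I.
move=> eta0; pose eta1 := Num.min eta 1.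
have eta1_gt0 : 0 < eta1 by rewrite lt_min eta0 ltr01.
have eta1_le1 : eta1 <= 1 by rewrite ge_min lexx orbT.
have eta1_le : eta1 <= eta by rewrite ge_min lexx.
have eta8 : 0 < eta1 / 8 by rewrite divr_gt0.
have [C C0 near_C] := core d_gt0 eta8.
have eta8_lt1 : 0 < eta1 / 8 < 1 by rewrite eta8 /=; lra.
apply: filterS (near_C _ (8 * (C + 1) / eta1) eta8_lt1) => r.
move=> [x [I [beta [xE IE vE beta_ge [I_ge I_le x_le]]]]].
rewrite dE /= in I_ge x_le.
exists x, I, beta; rewrite ler_pdivrMr // in beta_ge.
have beta0 : 0 < beta by rewrite -(pmulr_lgt0 _ eta1_gt0); lra.
have eta1_beta : eta1 * beta <= beta by rewrite ler_piMl // ltW.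
have dI : 3 / 4 * beta <= d * I by lra.
have I0 : 0 < I by rewrite -(pmulr_rgt0 _ d0); lra.
have eta_beta : eta1 * beta <= eta * beta by rewrite ler_pM2r.
have eta_I : eta1 * (3 / 4 * beta) <= eta * (d * I).
  by apply: ler_pM => //; [exact: ltW|rewrite mulr_ge0 // ltW].
have dI_x : d * I <= d * x by rewrite ler_pM2l.
split=> //; split.
  rewrite -(ler_pM2l d0) -{1}(gtr0_norm d0) -normrM mulrBr.
  have -> : d * (beta / d) = beta by rewrite mulrC divfK // gt_eqF.
  have -> : d * (eta * (beta / d)) = eta * beta by field; rewrite gt_eqF.
  by rewrite ler_norml; apply/andP; split; lra.
rewrite ger0_norm ?subr_ge0 // -(ler_pM2l d0) mulrBr mulrCA; lra.
Qed.

Lemma sandwich :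
  asymp_eq F (fun r => expected_cost c (t_ r) i)
             (fun r => (- lne (v r) / dstar p c i)%E) /\
  asymp_eq F (fun r => expected_cost c (t_ r) i)
             (fun r => inf_cost c (cls r) i).
Proof.
have [d [d0 dE _ _]] := dstar_value y0 p_pmf p_gt0 c_gt0 M_gt1 qs_opt.
move: d0; rewrite le_eqVlt => /predU1P[d0|d_gt0].
  by apply: sandwich_indistinguishable; rewrite dE -d0.
by apply: sandwich_distinguishable; rewrite dE lte_fin.
Qed.

End Sandwich.

Theorem mainTheorem4 (R : realType) (Y U : finType) (M : nat)
    (p : 'I_M -> U -> Y -> Y -> R) (y0 : Y) (c : U -> R)
    (qstar : 'I_M -> Y -> U -> R)
    (M_gt1 : (1 < M)%N)
    (p_pmf : forall i u yt, is_pmf (p i u yt))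
    (p_gt0 : forall i u yt y, 0 < p i u yt y)
    (c_gt0 : forall u, 0 < c u)
    (qstarP : forall i, attains_dstar p c i (qstar i)) :
  exists2 a0 : R, 1 < a0 & forall a : R, 1 < a < a0 ->
  forall ihat : seq (Y * U) -> 'I_M, is_ML p y0 a qstar ihat ->
  forall T : ('I_M -> R) -> seq_test p y0,
  (forall Rbar : 'I_M -> R, (forall i, 0 < Rbar i) ->
     is_proposed_test a qstar ihat Rbar (T Rbar)) ->
  (forall Rbar : 'I_M -> R, (forall i, 0 < Rbar i) ->
     forall i, (risk (T Rbar) i <= (Rbar i)%:E)%E) /\
  (forall (K : R) (i : 'I_M),
     [/\ asymp_eq (vanishing K)
           (fun Rbar => expected_cost c (T Rbar) i)
           (fun Rbar => ((- lne (P_max (T Rbar))) / dstar p c i)%E),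
         asymp_eq (vanishing K)
           (fun Rbar => expected_cost c (T Rbar) i)
           (fun Rbar => inf_cost c (class_C p y0 (P_max (T Rbar))) i),
         asymp_eq (vanishing K)
           (fun Rbar => expected_cost c (T Rbar) i)
           (fun Rbar => ((- lne (risk (T Rbar) i)) / dstar p c i)%E) &
         asymp_eq (vanishing K)
           (fun Rbar => expected_cost c (T Rbar) i)
           (fun Rbar => inf_cost c (class_C' p y0 (risk (T Rbar))) i)]).
Proof.
have [a0 a0_gt1 ML] := ML_errors_summable y0 p_pmf p_gt0.
exists a0 => // a /[dup] /ML {}ML /andP[a_gt1 _] ihat ihatP T TP.
have qsP i : is_cond_pmf (qstar i) by have [] := qstarP i.
have risk_le r : (forall i, 0 < r i) -> forall i, (risk (T r) i <= (r i)%:E)%E.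
  by move=> r0 i; exact: (proposed_risk p_pmf p_gt0 qsP r0 (TP r r0)).
split=> // K i; have FF := @vanishing_filter R M K.
have M0 : 0 < M%:R :> R by rewrite ltr0n ltnW.
have b_cvg (B : R) : vanishing K [set r : 'I_M -> R | B <= - ln (r i)].
  apply: (near_vanishing (expR_gt0 (- B))) => r r0 re _ /=.
  by rewrite lerNr -[leRHS]expRK ler_ln ?posrE ?expR_gt0 // ltW.
have cost_upper : (0 < dstar p c i)%E -> forall delta : R, 0 < delta ->
    exists C : R, vanishing K [set r | (expected_cost c (T r) i
      <= (((1 + delta) * - ln (r i) + C) / fine (dstar p c i))%:E)%E].
  move=> d_gt0 delta delta0.
  have [d [_ dE I_le _]] := dstar_value y0 p_pmf p_gt0 c_gt0 M_gt1 (qstarP i).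
  have d0 : 0 < d by rewrite -lte_fin -dE.
  have [|CML CML0 MLC] := ML qstar qsP ihat ihatP i.
    move=> j ji; apply: (info_rate_gt0_neq p_gt0 (qsP i)).
    by apply: lt_le_trans (I_le j ji); rewrite mulr_gt0 // cost_rate_gt0.
  have [C C0 le_C] := achievability_finite p_pmf p_gt0 c_gt0 a_gt1 qsP M_gt1
    (qstarP i) d_gt0 CML0 MLC delta0.
  exists C; apply: (near_vanishing ltr01) => r r0 r1 _ /=.
  have stopE := proposed_stop (TP r r0).
  apply: (expected_cost_bound p_pmf p_gt0 c_gt0 stopE) => n.
  rewrite dE /= in le_C *; rewrite ler_pdivlMr // mulrC.
  rewrite (proposed_policy (TP r r0)); apply: le_C.
    by rewrite oppr_ge0 ln_le0 // ltW.
  move=> h h0 hn llr_gt.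
  exact: (stop_rule_llr p_pmf p_gt0 c_gt0 qsP ihatP r0 M_gt1 (ltW (r1 i)) h0 hn llr_gt).
have P_max_le r : (forall i, 0 < r i) -> forall m : R, (forall j, r j <= m) ->
    (P_max (T r) <= (M%:R * m)%:E)%E.
  move=> r0 m r_le.
  have m0 : 0 <= m by apply: le_trans (r_le i); exact: ltW.
  apply: bigmax_le => [|k _]; first by rewrite lee_fin mulr_ge0 // ltW.
  apply: (@le_trans _ _ (\sum_(j < M | j != k) r j)%:E).
    apply: errs_le => // j jk.
    by apply: (proposed_accepts_le p_pmf p_gt0 qsP r0 (TP r r0)); rewrite eq_sym.
  rewrite lee_fin; apply: (@le_trans _ _ (\sum_(j < M) m)); last first.
    by rewrite sumr_const card_ord mulr_natl.
  rewrite big_mkcond; apply: ler_sum => j _; case: ifP => // _.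
have errs_P_max (t : seq_test p y0) j :
    (prob t j (errs_of t j) <= P_max t)%E.
  exact: (le_bigmax _ (fun j => prob t j (errs_of t j))).
have acc_errs (t : seq_test p y0) j : j != i ->
    (prob t j (accepts_of t i) <= prob t j (errs_of t j))%E.
  move=> ji; have [S stopE] := stop_first_time t; apply: le_measure.
  - by rewrite inE acceptsE; exact: measurable_decided stopE _.
  - by rewrite inE errsE; exact: measurable_decided stopE _.
  - move=> w [n Nw dec_i]; exists n => //; rewrite dec_i => ij.
    by rewrite ij eqxx in ji.
have [P1 P2] : asymp_eq (vanishing K) (fun r => expected_cost c (T r) i)
      (fun r => (- lne (P_max (T r)) / dstar p c i)%E) /\
    asymp_eq (vanishing K) (fun r => expected_cost c (T r) i)
      (fun r => inf_cost c (class_C p y0 (P_max (T r))) i).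
  apply: (sandwich p_pmf p_gt0 c_gt0 M_gt1 (qstarP i) (b := fun r => - ln (r i))
    (c0 := ln (M%:R * K))) => //.
  - by move=> r; apply: bigmax_ge_id.
  - apply: (near_vanishing ltr01) => r r0 _ rK /=.
    have K0 : 0 < K.
      by rewrite -(pmulr_lgt0 _ (r0 i)) (lt_le_trans (r0 i)).
    rewrite opprK expRD !lnK ?posrE ?mulr_gt0 // -mulrA.
    by apply: P_max_le => // j; exact: rK.
  - move=> r t t_cls j ji; apply: le_trans (acc_errs t j ji) _.
    exact: le_trans (errs_P_max t j) t_cls.
  - move=> e e0; have eM : 0 < e / M%:R by rewrite divr_gt0.
    apply: (near_vanishing eM) => r r0 re _ t t_cls.
    apply: le_trans (errs_P_max t i) _; apply: le_trans t_cls _.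
    rewrite -[e](divfK (lt0r_neq0 M0)) mulrC.
    by apply: P_max_le => // j; exact: ltW.
  - by move=> r; exact: lexx.
have [R1 R2] : asymp_eq (vanishing K) (fun r => expected_cost c (T r) i)
      (fun r => (- lne (risk (T r) i) / dstar p c i)%E) /\
    asymp_eq (vanishing K) (fun r => expected_cost c (T r) i)
      (fun r => inf_cost c (class_C' p y0 (risk (T r))) i).
  have acc_risk (t : seq_test p y0) k j : j != k ->
      (prob t j (accepts_of t k) <= risk t k)%E.
    move=> jk; exact: (@le_bigmax_cond _ _ _ 0%E j [pred j | j != k]
      (fun j => prob t j (accepts_of t k)) jk).
  apply: (sandwich p_pmf p_gt0 c_gt0 M_gt1 (qstarP i) (b := fun r => - ln (r i))
    (c0 := 0)) => //.
  - by move=> r; apply: bigmax_ge_id.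
  - apply: (near_vanishing ltr01) => r r0 _ rK /=.
    by rewrite sub0r opprK lnK ?posrE // risk_le.
  - by move=> r t t_cls j ji; exact: le_trans (acc_risk t i j ji) (t_cls i).
  - move=> e e0; have eM : 0 < e / M%:R by rewrite divr_gt0.
    apply: (near_vanishing eM) => r r0 re _ t t_cls.
    apply: (@le_trans _ _ (\sum_(j < M | j != i) r j)%:E).
      apply: errs_le => // j ji; apply: le_trans (acc_risk t j i _) _.
        by rewrite eq_sym.
      by apply: le_trans (t_cls j) _; exact: risk_le.
    rewrite lee_fin big_mkcond -[e](divfK (lt0r_neq0 M0)) mulr_natr.
    rewrite -[X in _ *+ X]card_ord -sumr_const; apply: ler_sum => j _.
    by case: ifP => _; exact: ltW.
  - by move=> r k; exact: lexx.
by split.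
Qed.
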